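(* Let $n\ge 1$ be an integer and let $p\in\mathbb{C}$ be arbitrary. The linear map $\varphi: U_q[sl(n+1)]\rightarrow W(n)$ defined on the generators by $$\varphi(h_1)=p-N-N_1,\qquad \varphi(h_i)=N_{i-1}-N_i,\quad i=2,3,\ldots,n,$$ $$\varphi(e_1)=\frac{[N_1+1]}{N_1+1}\,[p-N]\,a_1^-,\qquad \varphi(e_i)=\frac{[N_i+1]}{N_i+1}\,a_i^-a_{i-1}^+,\quad i=2,\ldots,n,$$ $$\varphi(f_1)=a_1^+,\qquad \varphi(f_i)=\frac{[N_{i-1}+1]}{N_{i-1}+1}\,a_i^+a_{i-1}^-,\quad i=2,\ldots,n,$$ is a morphism (of associative unital algebras) of $U_q[sl(n+1)]$ into $W(n)$.
   Context: Notation: $[a,b]=ab-ba$, $[a,b]_x=ab-x\,ba$, $\bar q=q^{-1}$. Let $\mathbb{C}[[h]]$ be the algebra of formal power series in the indeterminate $h$, and $q=e^{h/2}\in\mathbb{C}[[h]]$; accordingly $q^x=e^{hx/2}$. Put $[x]=\dfrac{q^x-\bar q^{\,x}}{q-\bar q}$ (square brackets with a single argument); $[x]/x$ is understood as the corresponding power series in $x$ (removable singularity at $x=0$). The quantum algebra $U_q[sl(n+1)]$ is the topologically free $\mathbb{C}[[h]]$-module (complete in the $h$-adic topology) and associative unital algebra generated by $h_i,e_i,f_i$, $i=1,\ldots,n$, subject to the following relations (the remaining Hopf algebra structure plays no role here). Cartan relations: $$[h_i,h_j]=0,\quad [h_i,e_j]=(2\delta_{ij}-\delta_{i,j-1}-\delta_{i-1,j})e_j,\quad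 [h_i,f_j]=-(2\delta_{ij}-\delta_{i,j-1}-\delta_{i-1,j})f_j,\quad [e_i,f_j]=\delta_{ij}\frac{q^{h_i}-\bar q^{\,h_i}}{q-\bar q}.$$ Serre relations: $$[e_i,e_j]=0,\quad [f_i,f_j]=0\quad\text{for } |i-j|\ne 1,$$ $$[e_i,[e_i,e_{i\pm1}]_{\bar q}]_q=[e_i,[e_i,e_{i\pm1}]_q]_{\bar q}=0,\qquad [f_i,[f_i,f_{i\pm1}]_{\bar q}]_q=[f_i,[f_i,f_{i\pm1}]_q]_{\bar q}=0$$ (whenever the indices lie in $\{1,\ldots,n\}$). The Weyl algebra $W(n)$ is the topologically free $\mathbb{C}[[h]]$-module (complete in the $h$-adic topology) and associative unital algebra generated by $a_1^\pm,\ldots,a_n^\pm$ with relations $$[a_i^-,a_j^+]=\delta_{ij},\qquad [a_i^+,a_j^+]=[a_i^-,a_j^-]=0,\qquad i,j=1,\ldots,n.$$ The number operators are $N_i=a_i^+a_i^-$ and $N=N_1+\cdots+N_n$. The functions of the number operators appearing in the claim are regarded as elements of $W(n)$. *)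

(* Defs.v *)
From HB Require Import structures.
From mathcomp Require Import all_boot all_order all_algebra.
From mathcomp Require Import generic_quotient ring_quotient complex.
From mathcomp Require Import boolp classical_sets reals.
From mathcomp Require Import monalg.

Set Implicit Arguments.
Unset Strict Implicit.
Unset Printing Implicit Defensive.

Import GRing.Theory Num.Theory.
Local Open Scope ring_scope.
Local Open Scope quotient_scope.

(* A[[h]]: the record [s] stands for the series sum_k (s k) h^k. *)
Record fps (A : Type) := Fps { fcoef :> nat -> A }.

Lemma fpsP (A : Type) (s t : fps A) : s =1 t -> s = t.
Proof. by case: s t => [s] [t] /= /funext ->. Qed.

HB.instance Definition _ (A : Type) := gen_eqMixin (fps A).
HB.instance Definition _ (A : Type) := gen_choiceMixin (fps A).

Definition fps_const (A : nmodType) (a : A) : fps A :=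
  Fps (fun k => if k == 0 then a else 0).

(* Meant for series with zero constant coefficient, where it is the exact
   division by h. *)
Definition fps_divh (A : Type) (s : fps A) : fps A := Fps (fun k => s k.+1).

Section Zmod.
Variable A : zmodType.
Implicit Types s t : fps A.

Let add s t : fps A := Fps (fun k => s k + t k).
Let opp s : fps A := Fps (fun k => - s k).
Let zero : fps A := Fps (fun=> 0).

Fact fps_addA : associative add.
Proof. by move=> s t u; apply: fpsP => k /=; rewrite addrA. Qed.
Fact fps_addC : commutative add.
Proof. by move=> s t; apply: fpsP => k /=; rewrite addrC. Qed.
Fact fps_add0 : left_id zero add.
Proof. by move=> s; apply: fpsP => k /=; rewrite add0r. Qed.
Fact fps_addN : left_inverse zero opp add.
Proof. by move=> s; apply: fpsP => k /=; rewrite addNr. Qed.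

HB.instance Definition _ :=
  GRing.isZmodule.Build (fps A) fps_addA fps_addC fps_add0 fps_addN.

Lemma fps_coefD s t k : (s + t) k = s k + t k. Proof. by []. Qed.
Lemma fps_coefN s k : (- s) k = - s k. Proof. by []. Qed.
Lemma fps_coef0 k : (0 : fps A) k = 0. Proof. by []. Qed.

End Zmod.

Section Ring.
Variable A : nzRingType.
Implicit Types s t : fps A.

Let mul s t : fps A := Fps (fun k => \sum_(i < k.+1) s i * t (k - i)%N).
Let one : fps A := fps_const 1.

Let tr (m : nat) s : {poly A} := \poly_(i < m) s i.

Fact mul_tr s t k m : (k < m)%N -> mul s t k = (tr m s * tr m t)`_k.
Proof.
move=> km; rewrite coefM /=; apply: eq_bigr => i _.
rewrite !coef_poly (leq_ltn_trans (leq_subr _ _) km).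
by rewrite (leq_ltn_trans _ km) // -ltnS.
Qed.

Fact fps_mulA : associative mul.
Proof.
move=> s t u; apply: fpsP => k.
transitivity ((tr k.+1 s * (tr k.+1 t * tr k.+1 u))`_k).
  rewrite coefM /=; apply: eq_bigr => i _; rewrite -(mul_tr t u).
    by rewrite coef_poly ltn_ord.
  by rewrite ltnS leq_subr.
rewrite mulrA coefM /=; apply: eq_bigr => i _; rewrite -mul_tr //.
by rewrite coef_poly ltnS leq_subr.
Qed.

Fact fps_mul1 : left_id one mul.
Proof.
move=> s; apply: fpsP => k /=; rewrite big_ord_recl /= mul1r subn0.
by rewrite big1 ?addr0 // => i _; rewrite mul0r.
Qed.

Fact fps_mulr1 : right_id one mul.
Proof.
move=> s; apply: fpsP => k /=; rewrite big_ord_recr /= subnn mulr1.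
rewrite big1 ?add0r // => i _.
by rewrite subn_eq0 leqNgt ltn_ord mulr0.
Qed.

Fact fps_mulDl : left_distributive mul +%R.
Proof.
move=> s t u; apply: fpsP => k; rewrite fps_coefD -big_split /=.
by apply: eq_bigr => i _; rewrite mulrDl.
Qed.

Fact fps_mulDr : right_distributive mul +%R.
Proof.
move=> s t u; apply: fpsP => k; rewrite fps_coefD -big_split /=.
by apply: eq_bigr => i _; rewrite mulrDr.
Qed.

Fact fps_1_neq0 : one != 0.
Proof. by apply/eqP => /(congr1 (fun s : fps A => s 0)) /eqP; rewrite oner_eq0. Qed.

HB.instance Definition _ := GRing.Zmodule_isNzRing.Build (fps A)
  fps_mulA fps_mul1 fps_mulr1 fps_mulDl fps_mulDr fps_1_neq0.

Lemma fps_coefM s t k : (s * t) k = \sum_(i < k.+1) s i * t (k - i)%N.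
Proof. by []. Qed.
Lemma fps_coef1 k : (1 : fps A) k = (k == 0)%:R.
Proof. by rewrite /= ; case: eqP. Qed.

Definition hvar : fps A := Fps (fun k => (k == 1)%:R).

End Ring.

Fact fps_mulC (A : comNzRingType) : commutative (@GRing.mul (fps A)).
Proof.
move=> s t; apply: fpsP => k; rewrite !fps_coefM (reindex_inj rev_ord_inj) /=.
by apply: eq_bigr => i _; rewrite subSS subKn -1?ltnS // mulrC.
Qed.
HB.instance Definition _ (A : comNzRingType) :=
  GRing.PzRing_hasCommutativeMul.Build (fps A) (@fps_mulC A).

Section UnitRing.
Variable K : fieldType.
Implicit Types s t : fps K.

(* The first m coefficients of the inverse of s. *)
Fixpoint inv_seq s (m : nat) : seq K :=
  if m is m'.+1 then
    let l := inv_seq s m' in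
    rcons l ((s 0)^-1 * ((m' == 0)%:R - \sum_(i < m') s i.+1 * l`_(m' - i.+1)))
  else [::].

Definition fps_unit : {pred fps K} := fun s => s 0 != 0.
Definition fps_inv s : fps K :=
  if s 0 == 0 then s else Fps (fun k => (inv_seq s k.+1)`_k).

Fact size_inv_seq s m : size (inv_seq s m) = m.
Proof. by elim: m => //= m IH; rewrite size_rcons IH. Qed.

Fact inv_seqS s m k : (k < m)%N -> (inv_seq s m)`_k = (inv_seq s k.+1)`_k.
Proof.
elim: m => // m IH; rewrite ltnS leq_eqVlt => /orP[/eqP->//|km].
by rewrite -IH //= nth_rcons size_inv_seq km.
Qed.

Fact fps_mulV : {in fps_unit, left_inverse 1 fps_inv *%R}.
Proof.
move=> s s0; rewrite mulrC; apply: fpsP => k; rewrite fps_coefM fps_coef1.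
rewrite /fps_inv (negPf s0) big_ord_recl subn0 /fcoef.
have -> : (inv_seq s k.+1)`_k =
    (s 0)^-1 * ((k == 0)%:R - \sum_(i < k) s i.+1 * (inv_seq s k)`_(k - i.+1)).
  by rewrite /= nth_rcons size_inv_seq ltnn eqxx.
rewrite mulrA divff // mul1r -[RHS]addr0 -addrA; congr (_ + _); apply/eqP.
rewrite addrC subr_eq0; apply/eqP; apply: eq_bigr => i _.
by rewrite -(@inv_seqS s k) // ltn_subrL /= (leq_trans _ (ltn_ord i)).
Qed.

Fact fps_unitP s t : t * s = 1 -> fps_unit s.
Proof.
move=> /(congr1 (fun u : fps K => u 0)); rewrite fps_coefM big_ord1 subn0 /=.
move=> ts; apply: contra_eq_neq ts => ->; rewrite mulr0 eq_sym; exact: oner_neq0.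
Qed.

Fact fps_inv_out : {in [predC fps_unit], fps_inv =1 id}.
Proof. by move=> s; rewrite inE /= /fps_inv negbK => ->. Qed.

HB.instance Definition _ :=
  GRing.ComNzRing_hasMulInverse.Build (fps K) fps_mulV fps_unitP fps_inv_out.

End UnitRing.

Section Algebra.
Variables (K : comNzRingType) (A : algType K).
Implicit Types (c d : fps K) (s t : fps A).

Definition fps_scale c s : fps A :=
  Fps (fun k => \sum_(i < k.+1) c i *: s (k - i)%N).

Let inA c : fps A := Fps (fun k => (c k)%:A).

Let scaleE c s : fps_scale c s = inA c * s.
Proof.
by apply: fpsP => k; rewrite fps_coefM; apply: eq_bigr => i _; rewrite mulr_algl.
Qed.

Let inAD c d : inA (c + d) = inA c + inA d.
Proof. by apply: fpsP => k; rewrite fps_coefD /= scalerDl. Qed.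

Let inAM c d : inA (c * d) = inA c * inA d.
Proof.
apply: fpsP => k; rewrite [LHS]/= scaler_suml fps_coefM.
by apply: eq_bigr => i _; rewrite /= mulr_algl scalerA.
Qed.

Let inA1 : inA 1 = 1.
Proof. by apply: fpsP => k /=; case: eqP; rewrite ?scale1r ?scale0r. Qed.

Let inAC c s : inA c * s = s * inA c.
Proof.
apply: fpsP => k; rewrite !fps_coefM (reindex_inj rev_ord_inj) /=.
apply: eq_bigr => i _; rewrite subSS subKn -1?ltnS //.
by rewrite mulr_algl mulr_algr.
Qed.

Fact fps_scaleA c d s : fps_scale c (fps_scale d s) = fps_scale (c * d) s.
Proof. by rewrite !scaleE inAM mulrA. Qed.
Fact fps_scale1 : left_id 1 fps_scale.
Proof. by move=> s; rewrite scaleE inA1 mul1r. Qed.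
Fact fps_scaleDr : right_distributive fps_scale +%R.
Proof. by move=> c s t; rewrite !scaleE mulrDr. Qed.
Fact fps_scaleDl s : {morph fps_scale^~ s : c d / c + d}.
Proof. by move=> c d; rewrite !scaleE inAD mulrDl. Qed.

HB.instance Definition _ := GRing.Zmodule_isLmodule.Build (fps K) (fps A)
  fps_scaleA fps_scale1 fps_scaleDr fps_scaleDl.

Fact fps_scaleAl c s t : c *: (s * t) = (c *: s) * t.
Proof. by rewrite -[LHS]/(fps_scale _ _) -[c *: s]/(fps_scale _ _) !scaleE mulrA. Qed.
HB.instance Definition _ :=
  GRing.Lmodule_isLalgebra.Build (fps K) (fps A) fps_scaleAl.

Fact fps_scaleAr c s t : c *: (s * t) = s * (c *: t).
Proof.
rewrite -[LHS]/(fps_scale _ _) -[c *: t]/(fps_scale _ _) !scaleE.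
by rewrite !mulrA inAC.
Qed.
HB.instance Definition _ :=
  GRing.Lalgebra_isAlgebra.Build (fps K) (fps A) fps_scaleAr.

Lemma fps_coefZ c s k : (c *: s) k = \sum_(i < k.+1) c i *: s (k - i)%N.
Proof. by []. Qed.

End Algebra.

(* For a free algebra A, hpres Rel is the h-adically complete K[[h]]-algebra
   presented by the generators of A and the relations Rel: the quotient of A[[h]]
   by the smallest h-adically closed two-sided ideal containing Rel. *)
Section Presentation.
Variables (K : comNzRingType) (A : algType K).
Implicit Types (I Rel : set (fps A)).

Record closed_ideal I : Prop := ClosedIdeal {
  closed_ideal0 : I 0;
  closed_idealB : forall x y, I x -> I y -> I (x - y);
  closed_idealMl : forall a x, I x -> I (a * x);
  closed_idealMr : forall a x, I x -> I (x * a);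
  closed_ideal_lim : forall x,
    (forall k, exists2 y, I y & exists z, x - y = hvar K ^+ k *: z) -> I x
}.

Definition gen_closed_ideal Rel : set (fps A) :=
  fun x => forall I, closed_ideal I -> (Rel `<=` I)%classic -> I x.

Lemma gen_closed_idealP Rel : closed_ideal (gen_closed_ideal Rel).
Proof.
split=> [I [] //|x y Ix Iy I cI RI|a x Ix I cI RI|a x Ix I cI RI|x xlim I cI RI].
- exact: closed_idealB (Ix I cI RI) (Iy I cI RI).
- exact: closed_idealMl (Ix I cI RI).
- exact: closed_idealMr (Ix I cI RI).
- apply: (closed_ideal_lim cI) => k; have [y Iy xy] := xlim k.
  by exists y => //; exact: Iy.
Qed.

Lemma sub_gen_closed_ideal Rel : (Rel `<=` gen_closed_ideal Rel)%classic.
Proof. by move=> x Rx I _; apply. Qed.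

Definition ideal_pred Rel : {pred fps A} := fun x => `[< gen_closed_ideal Rel x >].

Fact ideal_pred_zmod_closed Rel : zmod_closed (ideal_pred Rel).
Proof.
have cI := gen_closed_idealP Rel.
split; first by apply/asboolP; exact: closed_ideal0 cI.
move=> x y /asboolP Ix /asboolP Iy; apply/asboolP.
exact: (closed_idealB cI).
Qed.
HB.instance Definition _ Rel :=
  GRing.isZmodClosed.Build (fps A) (ideal_pred Rel) (ideal_pred_zmod_closed Rel).

Definition hpres Rel := Quotient.quot (ideal_pred Rel).
HB.instance Definition _ Rel := GRing.Zmodule.on (hpres Rel).
HB.instance Definition _ Rel := EqQuotient.on (hpres Rel).

Definition hpi Rel : fps A -> hpres Rel := \pi_(hpres Rel).

Section Quotient.
Variable Rel : set (fps A).
Let cI := gen_closed_idealP Rel.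
Local Notation pi := (@hpi Rel).

Lemma hpi_eq x y : pi x = pi y <-> gen_closed_ideal Rel (x - y).
Proof.
split=> [/eqP|xy]; last apply/eqP.
  by rewrite -[_ == _]Quotient.idealrBE => /asboolP.
by rewrite -[_ == _]Quotient.idealrBE; apply/asboolP.
Qed.

Lemma hpi_repr (u : hpres Rel) : pi (repr u) = u.
Proof. exact: reprK. Qed.

Fact hpiB : zmod_morphism pi.
Proof. by move=> x y; rewrite /hpi !piE. Qed.
HB.instance Definition _ := GRing.isZmodMorphism.Build (fps A) (hpres Rel) pi hpiB.

Definition hpres_mul (u v : hpres Rel) : hpres Rel := pi (repr u * repr v).
Definition hpres_scale (c : fps K) (u : hpres Rel) : hpres Rel := pi (c *: repr u).

Fact hpi_mul x y : hpres_mul (pi x) (pi y) = pi (x * y).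
Proof.
apply/hpi_eq; set x' := repr _; set y' := repr _.
have Ix : gen_closed_ideal Rel (x' - x) by apply/hpi_eq; rewrite hpi_repr.
have Iy : gen_closed_ideal Rel (y' - y) by apply/hpi_eq; rewrite hpi_repr.
have -> : x' * y' - x * y = (x' - x) * y' - (- x) * (y' - y).
  by rewrite mulrBl mulNr opprK mulrBr addrA subrK.
apply: (closed_idealB cI); first exact: (closed_idealMr cI).
exact: (closed_idealMl cI).
Qed.

Fact hpi_scale c x : hpres_scale c (pi x) = pi (c *: x).
Proof.
apply/hpi_eq; set x' := repr _.
rewrite -scalerBr -mulr_algl; apply: (closed_idealMl cI).
by apply/hpi_eq; rewrite hpi_repr.
Qed.

Fact hpres_mulA : associative hpres_mul.
Proof.
move=> u v w; rewrite -[u]hpi_repr -[v]hpi_repr -[w]hpi_repr.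
by rewrite !hpi_mul mulrA.
Qed.
Fact hpres_mul1 : left_id (pi 1) hpres_mul.
Proof. by move=> u; rewrite -[u]hpi_repr hpi_mul mul1r. Qed.
Fact hpres_mulr1 : right_id (pi 1) hpres_mul.
Proof. by move=> u; rewrite -[u]hpi_repr hpi_mul mulr1. Qed.
Fact hpres_mulDl : left_distributive hpres_mul +%R.
Proof.
move=> u v w; rewrite -[u]hpi_repr -[v]hpi_repr -[w]hpi_repr.
by rewrite -raddfD !hpi_mul mulrDl raddfD.
Qed.
Fact hpres_mulDr : right_distributive hpres_mul +%R.
Proof.
move=> u v w; rewrite -[u]hpi_repr -[v]hpi_repr -[w]hpi_repr.
by rewrite -raddfD !hpi_mul mulrDr raddfD.
Qed.

HB.instance Definition _ := GRing.Zmodule_isPzRing.Build (hpres Rel)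
  hpres_mulA hpres_mul1 hpres_mulr1 hpres_mulDl hpres_mulDr.

Fact hpi_monoid_morphism : monoid_morphism pi.
Proof. by split=> // x y; rewrite -hpi_mul. Qed.
HB.instance Definition _ :=
  GRing.isMonoidMorphism.Build (fps A) (hpres Rel) pi hpi_monoid_morphism.

Fact hpres_scaleA c d u : hpres_scale c (hpres_scale d u) = hpres_scale (c * d) u.
Proof. by rewrite -[u]hpi_repr !hpi_scale scalerA. Qed.
Fact hpres_scale1 : left_id 1 hpres_scale.
Proof. by move=> u; rewrite -[u]hpi_repr hpi_scale scale1r. Qed.
Fact hpres_scaleDr : right_distributive hpres_scale +%R.
Proof.
move=> c u v; rewrite -[u]hpi_repr -[v]hpi_repr.
by rewrite -raddfD !hpi_scale scalerDr raddfD.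
Qed.
Fact hpres_scaleDl u : {morph hpres_scale^~ u : c d / c + d}.
Proof. by move=> c d; rewrite -[u]hpi_repr !hpi_scale scalerDl raddfD. Qed.

HB.instance Definition _ := GRing.Zmodule_isLmodule.Build (fps K) (hpres Rel)
  hpres_scaleA hpres_scale1 hpres_scaleDr hpres_scaleDl.

Fact hpi_is_scalable : scalable pi.
Proof. by move=> c x; rewrite -hpi_scale. Qed.
HB.instance Definition _ :=
  GRing.isScalable.Build (fps K) (fps A) (hpres Rel) *:%R pi hpi_is_scalable.

(* lalgType and algType require 1 != 0, so their two axioms are stated apart. *)
Lemma hpres_scaleAl (c : fps K) (u v : hpres Rel) : c *: (u * v) = (c *: u) * v.
Proof.
rewrite -[u]hpi_repr -[v]hpi_repr -rmorphM -!linearZ -rmorphM.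
by rewrite scalerAl.
Qed.
Lemma hpres_scaleAr (c : fps K) (u v : hpres Rel) : c *: (u * v) = u * (c *: v).
Proof.
rewrite -[u]hpi_repr -[v]hpi_repr -rmorphM -!linearZ -rmorphM.
by rewrite scalerAr.
Qed.

End Quotient.
End Presentation.

Section FreeAlgebra.
Variables (K : comNzRingType) (G : choiceType).

Definition falg : Type := {malg K[{fmonom G}]}.
HB.instance Definition _ := GRing.Lalgebra.copy falg {malg K[{fmonom G}]}.

Fact falg_scaleAr (c : K) (x y : falg) : c *: (x * y) = x * (c *: y).
Proof.
have xc : malgC c * x = x * malgC c.
  rewrite [LHS]fgmulUg [RHS]fgmulgU; apply: eq_bigr => k _.
  by rewrite mulrC mul1m mulm1.
by rewrite -!mul_malgC !mulrA xc.
Qed.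
HB.instance Definition _ := GRing.Lalgebra_isAlgebra.Build K falg falg_scaleAr.

Definition fgen (g : G) : falg := mkmalgU (fmu g) 1.

End FreeAlgebra.

Section QNumbers.
Variable K : numFieldType.

(* e^{hx/2} *)
Definition qexp (A : algType K) (x : A) : fps A :=
  Fps (fun k => (2%:R ^+ k * k`!%:R : K)^-1 *: x ^+ k).

(* q = e^{h/2} *)
Definition qpar : fps K := Fps (fun k => (2%:R ^+ k * k`!%:R)^-1).

(* [x] = (q^x - q^{-x}) / (q - q^{-1}); numerator and denominator are both
   divided by h, after which the denominator is a unit of K[[h]]. *)
Definition qnum (A : algType K) (x : A) : fps A :=
  (fps_divh (qpar - qpar^-1))^-1 *: fps_divh (qexp x - qexp (- x)).

(* [x]/x: the coefficients of [X] are polynomials in X, all divisible by X. *)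
Definition qnum_div (A : algType K) (x : A) : fps A :=
  Fps (fun k => horner_alg x (qnum ('X : {poly K}) k %/ 'X)).

Lemma hvarM (s : fps K) : s 0 = 0 -> hvar K * fps_divh s = s.
Proof.
move=> s0; apply: fpsP => -[|k]; rewrite fps_coefM.
  by rewrite big_ord1 /= mul0r s0.
rewrite big_ord_recl big_ord_recl /= mul0r add0r mul1r subSS subn0 big1 ?addr0 //.
by move=> i _; rewrite /= mul0r.
Qed.

Lemma hvarZ (A : algType K) (s : fps A) : s 0 = 0 -> hvar K *: fps_divh s = s.
Proof.
move=> s0; apply: fpsP => -[|k]; rewrite fps_coefZ.
  by rewrite big_ord1 /= scale0r s0.
rewrite big_ord_recl big_ord_recl /= scale0r add0r scale1r subSS subn0 big1 ?addr0 //.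
by move=> i _; rewrite /= scale0r.
Qed.

Lemma qparVr : qpar * qpar^-1 = 1.
Proof. by rewrite divrr // unfold_in /= /fps_unit /= mulr1 invr1 oner_neq0. Qed.

Lemma qparV_coef0 : qpar^-1 0 = 1.
Proof.
have := congr1 (fun s : fps K => s 0) qparVr.
by rewrite fps_coefM big_ord1 /= mulr1 invr1 mul1r.
Qed.

Lemma qpar_sub_coef0 : (qpar - qpar^-1) 0 = 0.
Proof. by rewrite fps_coefD fps_coefN qparV_coef0 /= mulr1 invr1 subrr. Qed.

Lemma qpar_sub_coef1 : (qpar - qpar^-1) 1 = 1.
Proof.
have := congr1 (fun s : fps K => s 1) qparVr.
rewrite fps_coefM big_ord_recl big_ord1 !subn0 fps_coef1 [(1 - _)%N]/= qparV_coef0.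
rewrite [qpar _]/= !mulr1 invr1 mul1r => /eqP; rewrite addr_eq0 => /eqP e.
rewrite fps_coefD fps_coefN e opprK /= !mulr1.
by rewrite -mulr2n -(mulr_natr (2%:R^-1)) mulVf ?pnatr_eq0.
Qed.

Lemma qnumE (A : algType K) (x : A) :
  (qpar - qpar^-1) *: qnum x = qexp x - qexp (- x).
Proof.
rewrite -[X in X *: _](hvarM qpar_sub_coef0) /qnum !scalerA mulrK.
  by apply: hvarZ; rewrite fps_coefD fps_coefN /= !expr0 subrr.
by rewrite unfold_in /= /fps_unit [fcoef _ _]qpar_sub_coef1 oner_neq0.
Qed.

Lemma qnum_coef_horner (A : algType K) (x : A) k :
  horner_alg x (qnum ('X : {poly K}) k) = qnum x k.
Proof.
rewrite !fps_coefZ rmorph_sum /=; apply: eq_bigr => i _.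
rewrite -mul_polyC rmorphM /= horner_algC mulr_algl; congr (_ *: _).
rewrite rmorphB /= -!mul_polyC !rmorphM /= !horner_algC !mulr_algl.
by rewrite !rmorphXn /= rmorphN /= horner_algX.
Qed.

Lemma qnum_divE (A : algType K) (x : A) :
  fps_const x * qnum_div x = qnum x.
Proof.
apply: fpsP => k; rewrite fps_coefM big_ord_recl subn0.
rewrite [X in _ + X]big1 => [|i _]; last by rewrite [fcoef (fps_const x) _]/= mul0r.
rewrite addr0 [fcoef (fps_const x) _]/= [fcoef (qnum_div x) _]/fcoef /qnum_div.
rewrite -[RHS]qnum_coef_horner -[X in X * _](horner_algX x) -rmorphM mulrC divpK //.
rewrite fps_coefZ; apply: (big_ind (fun p => 'X %| p)) => [|p r|i _].
- exact: dvdp0.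
- exact: dvdp_add.
- rewrite -mul_polyC dvdp_mull // -[X in _ %| X]/(_ *: 'X^_ - _ *: (- 'X) ^+ _).
  by rewrite exprNn -!mul_polyC dvdp_sub ?dvdp_mull // exprS dvdp_mulIl.
Qed.

End QNumbers.

Definition comm (A : nzRingType) (a b : A) : A := a * b - b * a.

Definition qcomm (K : comNzRingType) (A : algType K) (x : fps K) (a b : fps A) :
  fps A := a * b - x *: (b * a).

(* Indices are shifted by one: i : 'I_n stands for i + 1 in {1, ..., n}. *)

Section QuantumAlgebra.
Variables (K : numFieldType) (n : nat).

Inductive Uq_gen : Type := genH of 'I_n | genE of 'I_n | genF of 'I_n.

Definition Uq_gen_code (g : Uq_gen) : 'I_n + ('I_n + 'I_n) :=
  match g with genH i => inl i | genE i => inr (inl i) | genF i => inr (inr i) end.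
Definition Uq_gen_decode (c : 'I_n + ('I_n + 'I_n)) : Uq_gen :=
  match c with inl i => genH i | inr (inl i) => genE i | inr (inr i) => genF i end.
Fact Uq_gen_codeK : cancel Uq_gen_code Uq_gen_decode. Proof. by case. Qed.
HB.instance Definition _ := Choice.copy Uq_gen (can_type Uq_gen_codeK).

Definition cartan (i j : 'I_n) : int :=
  2 * (i == j)%:Z - (i.+1 == j :> nat)%:Z - (i == j.+1 :> nat)%:Z.

Local Notation free := (falg K Uq_gen).
Local Notation q := (qpar K).
Local Notation H i := (fps_const (fgen K (genH i))).
Local Notation E i := (fps_const (fgen K (genE i))).
Local Notation F i := (fps_const (fgen K (genF i))).

(* Each relation lhs = rhs is recorded as the element lhs - rhs. *)
Inductive Uq_rel : fps free -> Prop :=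
| Uq_HH (i j : 'I_n) : Uq_rel (comm (H i) (H j))
| Uq_HE (i j : 'I_n) : Uq_rel (comm (H i) (E j) - E j *~ cartan i j)
| Uq_HF (i j : 'I_n) : Uq_rel (comm (H i) (F j) - F j *~ (- cartan i j))
| Uq_EF (i j : 'I_n) :
    Uq_rel (comm (E i) (F j) - (if i == j then qnum (fgen K (genH i)) else 0))
| Uq_EE (i j : 'I_n) : `|i - j|%N <> 1%N -> Uq_rel (comm (E i) (E j))
| Uq_FF (i j : 'I_n) : `|i - j|%N <> 1%N -> Uq_rel (comm (F i) (F j))
| Uq_EEE (i j : 'I_n) : `|i - j|%N = 1%N ->
    Uq_rel (qcomm q (E i) (qcomm q^-1 (E i) (E j)))
| Uq_EEE' (i j : 'I_n) : `|i - j|%N = 1%N ->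
    Uq_rel (qcomm q^-1 (E i) (qcomm q (E i) (E j)))
| Uq_FFF (i j : 'I_n) : `|i - j|%N = 1%N ->
    Uq_rel (qcomm q (F i) (qcomm q^-1 (F i) (F j)))
| Uq_FFF' (i j : 'I_n) : `|i - j|%N = 1%N ->
    Uq_rel (qcomm q^-1 (F i) (qcomm q (F i) (F j))).

Definition Uq := hpres Uq_rel.
HB.instance Definition _ := GRing.PzRing.on Uq.
HB.instance Definition _ := GRing.Lmodule.copy Uq (hpres Uq_rel).

Definition Uq_h (i : 'I_n) : Uq := hpi Uq_rel (H i).
Definition Uq_e (i : 'I_n) : Uq := hpi Uq_rel (E i).
Definition Uq_f (i : 'I_n) : Uq := hpi Uq_rel (F i).

End QuantumAlgebra.

Section WeylAlgebra.
Variables (K : numFieldType) (n : nat).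

Inductive Weyl_gen : Type := genAp of 'I_n | genAm of 'I_n.

Definition Weyl_gen_code (g : Weyl_gen) : 'I_n + 'I_n :=
  match g with genAp i => inl i | genAm i => inr i end.
Definition Weyl_gen_decode (c : 'I_n + 'I_n) : Weyl_gen :=
  match c with inl i => genAp i | inr i => genAm i end.
Fact Weyl_gen_codeK : cancel Weyl_gen_code Weyl_gen_decode. Proof. by case. Qed.
HB.instance Definition _ := Choice.copy Weyl_gen (can_type Weyl_gen_codeK).

Local Notation free := (falg K Weyl_gen).
Local Notation ap i := (fps_const (fgen K (genAp i))).
Local Notation am i := (fps_const (fgen K (genAm i))).

Inductive Weyl_rel : fps free -> Prop :=
| Weyl_mp (i j : 'I_n) : Weyl_rel (comm (am i) (ap j) - (i == j)%:R)
| Weyl_pp (i j : 'I_n) : Weyl_rel (comm (ap i) (ap j))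
| Weyl_mm (i j : 'I_n) : Weyl_rel (comm (am i) (am j)).

Definition Weyl := hpres Weyl_rel.
HB.instance Definition _ := GRing.PzRing.on Weyl.
HB.instance Definition _ := GRing.Lmodule.copy Weyl (hpres Weyl_rel).

Definition Weyl_ap (i : 'I_n) : Weyl := hpi Weyl_rel (ap i).
Definition Weyl_am (i : 'I_n) : Weyl := hpi Weyl_rel (am i).

(* The words a_i^+ a_i^- and their sum in the free algebra. A series
   sum_k g_k(x) h^k in a polynomial x of these words is formed before taking the
   quotient, where no convergence is needed; its class is the sum of the same
   series in the h-adically complete algebra Weyl. *)
Definition num_op (i : 'I_n) : free := fgen K (genAp i) * fgen K (genAm i).
Definition num_tot : free := \sum_i num_op i.
Definition to_Weyl : fps free -> Weyl := hpi Weyl_rel.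

Lemma num_opE (i : 'I_n) :
  to_Weyl (fps_const (num_op i)) = Weyl_ap i * Weyl_am i.
Proof.
rewrite /to_Weyl /Weyl_ap -rmorphM; congr (hpi _ _); apply: fpsP => k.
rewrite fps_coefM big_ord_recl subn0 big1 ?addr0 => [|j _] /=; last by rewrite mul0r.
by case: eqP => //; rewrite mulr0.
Qed.

End WeylAlgebra.

(* Main.v *)
(* Put X_i = [N_i+1]/(N_i+1) a_i^- and Y_i = a_i^+.  Since a_i^- and a_i^+ shift
   N_i by one, X_i Y_i = [N_i+1] and Y_i X_i = [N_i], and different modes commute.
   The images of the generators are e_1 = [p-N] X_1, f_1 = Y_1 and, for i > 1,
   e_i = X_i Y_{i-1}, f_i = X_{i-1} Y_i.  The Cartan relations are weight counts,
   [e_i, f_i] is the identity [a+1][b] - [a][b+1] = [b-a], and the Serre relations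
   reduce to [a+2] - (q+q^-1)[a+1] + [a] = 0 for one mode.  The factor [p-N] is
   harmless because every X_i Y_j with i <> j preserves N.

   The two identities follow from the addition formula
   [x+y] = [x] q^y + q^-x [y] for commuting x and y.  To obtain the morphism, the
   generators are lifted to A[[h]], with A the free algebra on the a_i^+-; the
   elements of the source that the lifted evaluation sends to 0 in W(n) form an
   h-adically closed ideal, hence it is enough that they include the relations. *)
Require Import Defs.
From HB Require Import structures.
From mathcomp Require Import all_boot all_order all_algebra.
From mathcomp Require Import complex reals boolp classical_sets monalg.
From mathcomp Require Import ring zify.

Set Implicit Arguments.
Unset Strict Implicit.
Unset Printing Implicit Defensive.

Import GRing.Theory Num.Theory.
Local Open Scope ring_scope.

(** * Morphisms out of an h-adic presentation *)

Section PowerSeries.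
Variables (K : comNzRingType) (A : algType K).
Implicit Types (a b : A) (s t : fps A) (c : fps K).

Lemma fps_constB (V : zmodType) : zmod_morphism (@fps_const V).
Proof. by move=> a b; apply: fpsP => -[|k] //=; rewrite subr0. Qed.
HB.instance Definition _ (V : zmodType) :=
  GRing.isZmodMorphism.Build V (fps V) (@fps_const V) (@fps_constB V).

Lemma fps_constMl (R : nzRingType) (a : R) (s : fps R) k :
  (fps_const a * s) k = a * s k.
Proof.
rewrite fps_coefM big_ord_recl subn0 big1 ?addr0 // => i _.
by rewrite /= mul0r.
Qed.

Lemma fps_constM (R : nzRingType) : monoid_morphism (@fps_const R).
Proof.
split=> // a b; apply: fpsP => k; rewrite fps_constMl /=.
by case: eqP; rewrite ?mulr0.
Qed.
HB.instance Definition _ (R : nzRingType) :=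
  GRing.isMonoidMorphism.Build R (fps R) (@fps_const R) (@fps_constM R).

Lemma fps_constZl (a : K) s k : (fps_const a *: s) k = a *: s k.
Proof.
rewrite fps_coefZ big_ord_recl subn0 big1 ?addr0 // => i _.
by rewrite /= scale0r.
Qed.

Lemma fps_constZ (c : K) a : fps_const (c *: a) = fps_const c *: fps_const a.
Proof. by apply: fpsP => k; rewrite fps_constZl /=; case: eqP; rewrite ?scaler0. Qed.

Lemma hvarZ_coef0 s : (hvar K *: s) 0%N = 0.
Proof. by rewrite fps_coefZ big_ord1 /= scale0r. Qed.

Lemma hvarZ_coefS s k : (hvar K *: s) k.+1 = s k.
Proof.
rewrite fps_coefZ big_ord_recl big_ord_recl /= scale0r add0r scale1r big1 ?addr0 //.
  by rewrite subSS subn0.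
by move=> i _; rewrite /= scale0r.
Qed.

(** This drives the inductions below: coefficient [k.+1] of a series is coefficient [k] of its tail,
    so constants and multiplication by [hvar] are the only cases to check. *)
Lemma fps_split s : s = fps_const (s 0%N) + hvar K *: fps_divh s.
Proof.
apply: fpsP => -[|k]; rewrite fps_coefD; first by rewrite hvarZ_coef0 addr0.
by rewrite hvarZ_coefS add0r.
Qed.

End PowerSeries.

(** * Extending an algebra map from [A] to [A[[h]]] *)

Section Extension.
Variables (K : comNzRingType) (A B : algType K) (ev : {rmorphism A -> fps B}).
Hypothesis evZ : forall (c : K) a, ev (c *: a) = fps_const c *: ev a.

(* The h-adically continuous K[[h]]-linear extension of ev to A[[h]]. *)
Definition fps_ext (s : fps A) : fps B :=
  Fps (fun k => \sum_(i < k.+1) ev (s i) (k - i)%N).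
Arguments fps_ext : simpl never.

Lemma fps_ext_coef s k : fps_ext s k = \sum_(i < k.+1) ev (s i) (k - i)%N.
Proof. by []. Qed.

Lemma fps_extB : zmod_morphism fps_ext.
Proof.
move=> s t; apply: fpsP => k; rewrite fps_coefD fps_coefN !fps_ext_coef -sumrB.
by apply: eq_bigr => i _; rewrite rmorphB.
Qed.
HB.instance Definition _ :=
  GRing.isZmodMorphism.Build (fps A) (fps B) fps_ext fps_extB.

Lemma fps_extD s t : fps_ext (s + t) = fps_ext s + fps_ext t.
Proof. exact: raddfD. Qed.

Lemma fps_ext_const a : fps_ext (fps_const a) = ev a.
Proof.
apply: fpsP => k; rewrite fps_ext_coef big_ord_recl subn0 big1 ?addr0 // => i _.
by rewrite rmorph0.
Qed.

Lemma fps_ext_hvar s : fps_ext (hvar K *: s) = hvar K *: fps_ext s.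
Proof.
apply: fpsP => -[|k]; rewrite ?hvarZ_coefS ?hvarZ_coef0.
  by rewrite [LHS]big_ord1 [fcoef (_ *: _) _]hvarZ_coef0 rmorph0.
rewrite [LHS]big_ord_recl [fcoef (_ *: _) ord0]hvarZ_coef0 rmorph0 add0r.
by apply: eq_bigr => i _; rewrite [fcoef (_ *: _) _]hvarZ_coefS.
Qed.

(** Two inductions on the coefficient: [constM] peels constant terms off the right factor next to a
    constant, then the left factor is peeled in the same way. The tails enter through [hvar], with
    which [fps_ext] commutes. *)
Lemma fps_extM : monoid_morphism fps_ext.
Proof.
split; first by rewrite -[X in fps_ext X](rmorph1 (@fps_const A)) fps_ext_const rmorph1.
have constM a t : fps_ext (fps_const a * t) = ev a * fps_ext t.
  apply: fpsP => k; elim: k t => [|k IH] t;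
    rewrite [t in LHS](fps_split t) [t in RHS](fps_split t) mulrDr -scalerAr;
    rewrite !fps_extD !fps_ext_hvar -rmorphM !fps_ext_const rmorphM mulrDr;
    rewrite -scalerAr !fps_coefD; congr (_ + _).
    by rewrite !hvarZ_coef0.
  by rewrite !hvarZ_coefS.
move=> s t; apply: fpsP => k; elim: k s => [|k IH] s;
  rewrite [s in LHS](fps_split s) [s in RHS](fps_split s) mulrDl -scalerAl;
  rewrite !fps_extD !fps_ext_hvar constM fps_ext_const mulrDl -scalerAl;
  rewrite !fps_coefD; congr (_ + _).
  by rewrite !hvarZ_coef0.
by rewrite !hvarZ_coefS.
Qed.
HB.instance Definition _ :=
  GRing.isMonoidMorphism.Build (fps A) (fps B) fps_ext fps_extM.

Lemma fps_extZ (c : fps K) s : fps_ext (c *: s) = c *: fps_ext s.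
Proof.
have constZ a t : fps_ext (fps_const a *: t) = fps_const a *: fps_ext t.
  apply: fpsP => k; rewrite fps_constZl !fps_ext_coef scaler_sumr.
  apply: eq_bigr => i _.
  by rewrite [fcoef (_ *: _) _]fps_constZl evZ [fcoef (_ *: _) _]fps_constZl.
apply: fpsP => k.
elim: k c => [|k IH] c; rewrite (@fps_split _ K^o c) !scalerDl !fps_extD.
  rewrite constZ -!scalerA fps_ext_hvar !fps_coefD; congr (_ + _).
  by rewrite !hvarZ_coef0.
rewrite constZ -!scalerA fps_ext_hvar !fps_coefD; congr (_ + _).
by rewrite !hvarZ_coefS.
Qed.

End Extension.

(** * Evaluation of the free algebra in power series *)

Section FreeEvaluation.
Variables (K : comNzRingType) (G : choiceType) (B : algType K) (v : G -> fps B).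

Definition fmon_eval (m : {fmonom G}) : fps B := \prod_(g <- (m : seq G)) v g.

Lemma fmon_eval_mmorphism : mmorphism fmon_eval.
Proof.
by split=> [x y|]; rewrite /fmon_eval ?fmM ?fm1 ?big_cat ?big_nil.
Qed.
HB.instance Definition _ :=
  isMultiplicative.Build {fmonom G} (fps B) fmon_eval fmon_eval_mmorphism.

Definition scalar_series (c : K) : fps B := (fps_const c)%:A.

Lemma scalar_series_zmod_morphism : zmod_morphism scalar_series.
Proof. by move=> a b; rewrite /scalar_series rmorphB scalerBl. Qed.
Lemma scalar_series_monoid_morphism : monoid_morphism scalar_series.
Proof.
split=> [|a b]; first by rewrite /scalar_series rmorph1 scale1r.
by rewrite /scalar_series rmorphM -scalerAl mul1r scalerA.
Qed.
HB.instance Definition _ :=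
  GRing.isZmodMorphism.Build K (fps B) scalar_series scalar_series_zmod_morphism.
HB.instance Definition _ :=
  GRing.isMonoidMorphism.Build K (fps B) scalar_series scalar_series_monoid_morphism.

Definition falg_eval (x : falg K G) : fps B := mmap scalar_series fmon_eval x.

Lemma falg_evalB : zmod_morphism falg_eval.
Proof. by move=> x y; exact: mmapB. Qed.
Lemma falg_evalM : monoid_morphism falg_eval.
Proof.
have [M1 M2] : multiplicative (mmap scalar_series fmon_eval).
  (* For a noncommutative target, the images of coefficients must commute with those of monomials;
     scalar series are central. *)
  apply: commr_mmap_is_multiplicative => g m m'.
  by rewrite /GRing.comm /= /scalar_series -scalerAl mul1r -scalerAr mulr1.
by split.
Qed.
HB.instance Definition _ :=
  GRing.isZmodMorphism.Build (falg K G) (fps B) falg_eval falg_evalB.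
HB.instance Definition _ :=
  GRing.isMonoidMorphism.Build (falg K G) (fps B) falg_eval falg_evalM.

Lemma falg_evalZ c (x : falg K G) : falg_eval (c *: x) = fps_const c *: falg_eval x.
Proof. by rewrite [LHS]mmapZ /= /scalar_series -scalerAl mul1r. Qed.

Lemma falg_eval_gen g : falg_eval (fgen K g) = v g.
Proof.
by rewrite [LHS]mmapU /= [scalar_series 1]rmorph1 mul1r /fmon_eval fmU big_seq1.
Qed.

End FreeEvaluation.

(** * Universal property of an h-adic presentation *)

Section UniversalProperty.
Variables (K : comNzRingType) (A B : algType K) (ev : {rmorphism A -> fps B}).
Variables (Rel : set (fps A)) (RelB : set (fps B)).
Hypothesis evZ : forall (c : K) a, ev (c *: a) = fps_const c *: ev a.
Hypothesis Rel0 : forall r, Rel r -> hpi RelB (fps_ext ev r) = 0.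

(** The series sent to 0 form an h-adically closed ideal containing [Rel], hence contain the
    smallest such ideal. *)
Lemma fps_ext_gen_closed_ideal s :
  gen_closed_ideal Rel s -> hpi RelB (fps_ext ev s) = 0.
Proof.
move=> /(_ (fun t => hpi RelB (fps_ext ev t) = 0)); apply=> [|r]; last exact: Rel0.
split=> [|x y hx hy|a x hx|a x hx|x xlim].
- by rewrite !rmorph0.
- by rewrite (rmorphB (fps_ext ev)) /= rmorphB /= hx hy subrr.
- by rewrite (rmorphM (fps_ext ev)) /= rmorphM /= hx mulr0.
- by rewrite (rmorphM (fps_ext ev)) /= rmorphM /= hx mul0r.
(* Limits: by K[[h]]-linearity, [fps_ext ev] preserves divisibility by [h^k], so the image of [x] is
   a limit of elements of the closed ideal of [RelB]. *)
have cI := gen_closed_idealP RelB.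
rewrite -(rmorph0 (hpi RelB)); apply/hpi_eq; rewrite subr0.
apply: (closed_ideal_lim cI) => k; have [y y0 [z xyz]] := xlim k.
exists (fps_ext ev y).
  by rewrite -[fps_ext ev y]subr0; apply/hpi_eq; rewrite y0 rmorph0.
by exists (fps_ext ev z); rewrite -(fps_extB ev) xyz (fps_extZ evZ).
Qed.

(** The map is defined on chosen representatives; [fE] shows independence of the choice, after which
    the algebra laws descend from [fps_ext ev]. *)
Lemma hpres_lift : exists phi : {rmorphism hpres Rel -> hpres RelB},
  (forall c u, phi (c *: u) = c *: phi u) /\
  (forall s, phi (hpi Rel s) = hpi RelB (fps_ext ev s)).
Proof.
pose f (u : hpres Rel) := hpi RelB (fps_ext ev (repr u)).
have fE s : f (hpi Rel s) = hpi RelB (fps_ext ev s).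
  apply/eqP; rewrite -subr_eq0 -rmorphB -(fps_extB ev); apply/eqP.
  by apply: fps_ext_gen_closed_ideal; apply/hpi_eq; rewrite hpi_repr.
have fB : zmod_morphism f.
  move=> u w; rewrite -[u]hpi_repr -[w]hpi_repr -rmorphB !fE.
  by rewrite (rmorphB (fps_ext ev)) /= rmorphB.
have fM : monoid_morphism f.
  split=> [|u w]; first by rewrite -(rmorph1 (hpi Rel)) fE !rmorph1.
  rewrite -[u]hpi_repr -[w]hpi_repr -rmorphM !fE.
  by rewrite (rmorphM (fps_ext ev)) /= rmorphM.
pose fz := GRing.isZmodMorphism.Build _ _ f fB.
pose fm := GRing.isMonoidMorphism.Build _ _ f fM.
pose phi : {rmorphism hpres Rel -> hpres RelB} := HB.pack f fz fm.
exists phi; split=> // c u.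
by rewrite /= -[u]hpi_repr -linearZ /= !fE (fps_extZ evZ) linearZ.
Qed.

End UniversalProperty.

(** * Equality and intertwining in a presented algebra *)

Section Presented.
Variables (K : comNzRingType) (A : algType K) (Rel : set (fps A)).
Local Notation W := (hpres Rel).
Local Notation h := (hvar K).

Definition pconst (a : A) : W := hpi Rel (fps_const a).

Lemma pconstB : zmod_morphism pconst.
Proof. by move=> a b; rewrite /pconst !rmorphB. Qed.
Lemma pconstM : monoid_morphism pconst.
Proof. by split=> [|a b]; rewrite /pconst ?rmorph1 ?rmorphM. Qed.
HB.instance Definition _ := GRing.isZmodMorphism.Build A W pconst pconstB.
HB.instance Definition _ := GRing.isMonoidMorphism.Build A W pconst pconstM.

Lemma pconstX a m : pconst (a ^+ m) = pconst a ^+ m.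
Proof. exact: rmorphXn. Qed.

Lemma pconstZ (c : K) a : pconst (c *: a) = fps_const c *: pconst a.
Proof. by rewrite /pconst fps_constZ linearZ. Qed.

Lemma hpi_comm (a b : A) : hpi Rel (comm (fps_const a) (fps_const b)) =
  pconst a * pconst b - pconst b * pconst a.
Proof. by rewrite /comm rmorphB !rmorphM. Qed.

(* Equality in a presented algebra can be tested on the coefficients of
   representatives because the defining ideal is closed. *)
Lemma hpres_hausdorff (u : W) : (forall k, exists z : W, u = h ^+ k *: z) -> u = 0.
Proof.
move=> hu; rewrite -(hpi_repr u) -(rmorph0 (hpi Rel)); apply/hpi_eq; rewrite subr0.
apply: (closed_ideal_lim (gen_closed_idealP Rel)) => k; have [z uz] := hu k.
exists (repr u - h ^+ k *: repr z); last first.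
  by exists (repr z); rewrite opprB addrC subrK.
by apply/hpi_eq; rewrite linearZ /= !hpi_repr.
Qed.

(** Peeling off [k] constant terms shows that the difference of the two sides is divisible by [h^k];
    this holds for all [k], so the difference vanishes. *)
Lemma hpi_intertwine (b : W) (s t : fps A) :
  (forall k, b * pconst (s k) = pconst (t k) * b) -> b * hpi Rel s = hpi Rel t * b.
Proof.
move=> bst; apply/eqP; rewrite -subr_eq0; apply/eqP; apply: hpres_hausdorff => k.
elim: k s t bst => [|k IH] s t bst.
  by eexists; rewrite expr0 scale1r.
have [z e] := IH (fps_divh s) (fps_divh t) (fun i => bst i.+1).
exists z; rewrite (fps_split s) (fps_split t) !rmorphD /= !linearZ /= mulrDr mulrDl.
rewrite [hpi Rel (fps_const _)](erefl (pconst _)).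
rewrite -[hpi Rel (fps_const (t _))]/(pconst _) bst opprD addrACA subrr add0r.
by rewrite -hpres_scaleAr -hpres_scaleAl -scalerBr e scalerA exprS.
Qed.

Lemma eq_hpi_coef (s t : fps A) :
  (forall k, pconst (s k) = pconst (t k)) -> hpi Rel s = hpi Rel t.
Proof.
move=> st; have := @hpi_intertwine 1 s t; rewrite mul1r mulr1; apply=> k.
by rewrite mul1r mulr1.
Qed.

(** The coefficients of [q^x], [[x]] and [[x]/x] are polynomials in [x]. Together with
    [hpi_intertwine], this carries such functions past [b], turning [x] into [y]. *)
Lemma pconst_horner_intertwine (b : W) (x y : A) (p : {poly K}) :
  b * pconst x = pconst y * b ->
  b * pconst (horner_alg x p) = pconst (horner_alg y p) * b.
Proof.
move=> bxy; elim/poly_ind: p => [|p c IH]; first by rewrite !rmorph0 mulr0 mul0r.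
rewrite !rmorphD !rmorphM /= !horner_algX !horner_algC mulrDr mulrDl.
rewrite mulrA IH -mulrA bxy mulrA; congr (_ + _).
by rewrite !pconstZ rmorph1 -hpres_scaleAr -hpres_scaleAl mulr1 mul1r.
Qed.

End Presented.

(** * Functions of number operators in a presented algebra *)

Section QNumberIdentities.
Variables (K : numFieldType) (A : algType K) (Rel : set (fps A)).
Local Notation W := (hpres Rel).
Local Notation q := (qpar K).
Implicit Types (x y : A) (b : W).
Local Notation rho := (pconst Rel).

Definition pqexp x : W := hpi Rel (qexp x).
Definition pqnum x : W := hpi Rel (qnum x).
Definition pqdiv x : W := hpi Rel (qnum_div x).

Lemma pqnum_intertwine b x y : b * rho x = rho y * b -> b * pqnum x = pqnum y * b.
Proof.
move=> bxy; apply: hpi_intertwine => k.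
rewrite -(qnum_coef_horner x) -(qnum_coef_horner y).
exact: pconst_horner_intertwine.
Qed.

Lemma pqexp_intertwine b x y : b * rho x = rho y * b -> b * pqexp x = pqexp y * b.
Proof.
move=> bxy; apply: hpi_intertwine => k.
have e z : qexp z k = horner_alg z (q k *: 'X^k).
  rewrite -[_ *: 'X^_]mul_polyC rmorphM /= horner_algC rmorphXn /= horner_algX.
  by rewrite mulr_algl.
by rewrite !e; exact: pconst_horner_intertwine.
Qed.

Lemma pqdiv_intertwine b x y : b * rho x = rho y * b -> b * pqdiv x = pqdiv y * b.
Proof.
by move=> bxy; apply: hpi_intertwine => k; exact: pconst_horner_intertwine.
Qed.

Lemma pqdivE x : rho x * pqdiv x = pqnum x.
Proof. by rewrite -[RHS](congr1 _ (qnum_divE x)) rmorphM. Qed.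

(** Converts the binomial theorem into the Cauchy product of exponential series. *)
Lemma qpar_bin k i : (i <= k)%N -> q k * 'C(k, i)%:R = q i * q (k - i)%N.
Proof.
move=> ik /=; rewrite -(bin_fact ik) -{1}(subnK ik) addnC exprD !natrM !invfM.
have := bin_gt0 k i; rewrite ik lt0n -(pnatr_eq0 K) => b0.
have f0 m : (m`!%:R : K) != 0 by rewrite pnatr_eq0 -lt0n fact_gt0.
have t0 m : (2 ^+ m : K) != 0 by rewrite expf_neq0 // pnatr_eq0.
by field; rewrite ?b0 ?f0 ?t0.
Qed.

(** This is [q^-1 = e^(-h/2)]: by the binomial theorem, coefficient [m] of the product of both
    exponentials is [q m * (- 1 + 1) ^+ m]. *)
Lemma qparVE k : q^-1 k = (-1) ^+ k * q k.
Proof.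
have qq : q * Fps (fun k => (-1) ^+ k * q k) = 1.
  apply: fpsP => m; rewrite fps_coefM fps_coef1.
  transitivity (q m * (- 1 + 1) ^+ m); last first.
    by rewrite addNr expr0n; case: m => [|m]; rewrite ?mulr0 //= mulr1 mulr1 invr1.
  rewrite exprDn mulr_sumr; apply: eq_bigr => i _.
  have im : (i <= m)%N by rewrite -ltnS.
  by rewrite expr1n mulr1 -mulr_natr [RHS]mulrCA qpar_bin //; exact: mulrCA.
by rewrite -[q^-1]mulr1 -qq mulKr // unfold_in /= /fps_unit /= mulr1 invr1 oner_neq0.
Qed.

(** Since [x] and [y] commute only in the quotient, the two coefficients are compared after applying
    [rho], not in the free algebra. *)
Lemma pconst_qexpD x y k : GRing.comm (rho x) (rho y) ->
  rho (qexp (x + y) k) = rho ((qexp x * qexp y) k).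
Proof.
move=> cxy; rewrite fps_coefM rmorph_sum /= pconstZ pconstX rmorphD /=.
rewrite addrC (exprDn_comm _ (commr_sym cxy)) scaler_sumr; apply: eq_bigr => i _.
rewrite -scalerAl -scalerAr scalerA pconstZ (rmorphM (pconst Rel)) /= !pconstX.
rewrite (commrX _ (commr_sym (commrX _ cxy))) -scaler_nat scalerA.
congr (_ *: _); rewrite -(rmorph_nat (@fps_const K)) -rmorphM; congr fps_const.
by apply: qpar_bin; rewrite -ltnS.
Qed.

Lemma pqexpD x y : GRing.comm (rho x) (rho y) -> pqexp (x + y) = pqexp x * pqexp y.
Proof.
move=> cxy; rewrite -rmorphM; apply: eq_hpi_coef => k; exact: pconst_qexpD.
Qed.

Lemma fps_alg (c : fps K) k : (c *: (1 : fps A)) k = (c k)%:A.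
Proof.
rewrite fps_coefZ big_ord_recr /= subnn big1 ?add0r // => i _.
by rewrite subn_eq0 leqNgt ltn_ord scaler0.
Qed.

Lemma qexp1 : qexp (1 : A) = q *: (1 : fps A).
Proof. by apply: fpsP => k; rewrite fps_alg /= expr1n. Qed.

Lemma qexpN1 : qexp (- 1 : A) = q^-1 *: (1 : fps A).
Proof.
apply: fpsP => k; rewrite fps_alg qparVE mulrC -scalerA /=; congr (_ *: _).
exact: esym (rmorph_sign (in_alg A) k).
Qed.

Lemma pqexp1 : pqexp 1 = q *: (1 : W).
Proof. by rewrite /pqexp qexp1 linearZ rmorph1. Qed.

Lemma pqexpN1 : pqexp (- 1) = q^-1 *: (1 : W).
Proof. by rewrite /pqexp qexpN1 linearZ rmorph1. Qed.

Lemma fps_divhM (s t : fps A) : s 0%N = 0 -> fps_divh (s * t) = fps_divh s * t.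
Proof.
move=> s0; apply: fpsP => k; rewrite [LHS]fps_coefM big_ord_recl s0 mul0r add0r.
by apply: eq_bigr => i _; rewrite subSS.
Qed.

Lemma fps_divhMr (s t : fps A) : t 0%N = 0 -> fps_divh (s * t) = s * fps_divh t.
Proof.
move=> t0; apply: fpsP => k; rewrite [LHS]fps_coefM big_ord_recr /= subnn t0.
rewrite mulr0 addr0; apply: eq_bigr => i _.
by rewrite /= subSn // -ltnS.
Qed.

Lemma qexp_subN_coef0 x : (qexp x - qexp (- x)) 0%N = 0.
Proof. by rewrite fps_coefD fps_coefN /= !expr0 subrr. Qed.

(* Holds at the level of D(x) = (q^x - q^-x)/h, so that no cancellation of h,
   which could fail in a presented algebra, is needed. *)
Lemma pqnumD x y : GRing.comm (rho x) (rho y) ->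
  pqnum (x + y) = pqnum x * pqexp y + pqexp (- x) * pqnum y.
Proof.
move=> cxy; rewrite /pqnum /qnum !linearZ /= -hpres_scaleAl -hpres_scaleAr -scalerDr.
congr (_ *: _); rewrite -!rmorphM -rmorphD -fps_divhM ?qexp_subN_coef0 //.
rewrite -fps_divhMr ?qexp_subN_coef0 //.
apply: eq_hpi_coef => k.
have cNxy : GRing.comm (rho (- x)) (rho (- y)).
  by rewrite !rmorphN; apply: commrN; apply/commr_sym/commrN/commr_sym.
rewrite -[LHS]/(rho (qexp (x + y) k.+1 - qexp (- (x + y)) k.+1)) opprD rmorphB /=.
rewrite !pconst_qexpD // -[LHS]rmorphB; congr pconst.
(* The claim is coefficient [k.+1] of the equality of the two series [s] and [t], in which the cross
   terms [q^-x q^y] cancel. *)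
pose s := qexp x * qexp y - qexp (- x) * qexp (- y).
pose t := (qexp x - qexp (- x)) * qexp y + qexp (- x) * (qexp y - qexp (- y)).
rewrite -[LHS]/(s k.+1) -[RHS]/(t k.+1); congr fcoef.
by rewrite /s /t mulrBl mulrBr addrA subrK.
Qed.

Lemma pqnumN x : pqnum (- x) = - pqnum x.
Proof.
rewrite /pqnum /qnum opprK -rmorphN -scalerN; congr (hpi _ (_ *: _)).
by apply: fpsP => k; rewrite fps_coefN -[RHS]/(- (_ - _)) opprB.
Qed.

Lemma qnum1 : qnum (1 : A) = 1.
Proof.
rewrite /qnum qexp1 qexpN1 -scalerBl; set c := fps_divh (q - q^-1).
have -> : fps_divh ((q - q^-1) *: (1 : fps A)) = c *: (1 : fps A).
  by apply: fpsP => k; rewrite [LHS]fps_alg fps_alg.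
rewrite scalerA mulVr ?scale1r // unfold_in /= /fps_unit.
by rewrite [fcoef _ _]qpar_sub_coef1 oner_neq0.
Qed.

Lemma pqnum1 : pqnum 1 = 1.
Proof. by rewrite /pqnum qnum1 rmorph1. Qed.

Lemma pqnumS x : pqnum (x + 1) = q *: pqnum x + pqexp (- x).
Proof.
rewrite pqnumD ?rmorph1; last exact: commr1.
by rewrite pqnum1 mulr1 pqexp1 -hpres_scaleAr mulr1.
Qed.

Lemma pqnum_comm x y : GRing.comm (rho x) (rho y) -> GRing.comm (pqnum x) (pqnum y).
Proof. by move=> /pqnum_intertwine/esym/pqnum_intertwine/esym. Qed.

(** With [[x+1] = q [x] + q^-x], and likewise for [y], the terms [q [x] [y]] cancel. What remains,
    [q^-x [y] - [x] q^-y], is the addition formula for [y + (- x)] up to the order of commuting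
    factors. *)
Lemma pqnum_det x y : GRing.comm (rho x) (rho y) ->
  pqnum (x + 1) * pqnum y - pqnum x * pqnum (y + 1) = pqnum (y - x).
Proof.
move=> cxy; rewrite !pqnumS mulrDl mulrDr -hpres_scaleAl -hpres_scaleAr opprD.
rewrite addrACA subrr add0r pqnumD; last first.
  by rewrite rmorphN; apply: commrN; exact: commr_sym.
have cx : GRing.comm (pqnum x) (rho y) by exact/esym/pqnum_intertwine/esym.
have cy : GRing.comm (pqnum y) (rho x) by exact/esym/pqnum_intertwine.
rewrite pqnumN mulrN; congr (_ - _).
  by apply/esym/pqexp_intertwine; rewrite rmorphN /= mulrN mulNr cy.
by apply/pqexp_intertwine; rewrite rmorphN /= mulrN mulNr cx.
Qed.

(** From [[x+2] = q [x+1] + q^-1 q^-x], where [q^-x] is eliminated by [q^-x = [x+1] - q [x]]. *)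
Lemma pqnum_recurrence x :
  pqnum (x + 2) - (q + q^-1) *: pqnum (x + 1) + pqnum x = 0.
Proof.
have -> : x + 2 = x + 1 + 1 by rewrite -addrA.
rewrite (pqnumS (x + 1)).
have -> : pqexp (- (x + 1)) = q^-1 *: pqexp (- x).
  rewrite opprD pqexpD ?rmorphN ?rmorph1; last exact: commrN1.
  by rewrite pqexpN1 -hpres_scaleAr mulr1.
have -> : pqexp (- x) = pqnum (x + 1) - q *: pqnum x by rewrite pqnumS addrC addKr.
rewrite scalerDl scalerBr scalerA mulrC qparVr scale1r addrA.
by rewrite [X in X + _]addrAC subrr add0r addNr.
Qed.

End QNumberIdentities.

(** * q-oscillators and the quantum relations *)

Section Weight.
Variable W : pzRingType.
Implicit Types (H u v : W) (a b : int).

Definition has_weight H u a := H * u - u * H = u *~ a.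

Lemma has_weight0 H u : has_weight H u 0 <-> GRing.comm u H.
Proof.
rewrite /has_weight mulr0z; split=> [/eqP|->]; last exact: subrr.
by rewrite subr_eq0 => /eqP.
Qed.

Lemma has_weightM H u v a b :
  has_weight H u a -> has_weight H v b -> has_weight H (u * v) (a + b).
Proof.
rewrite /has_weight => hu hv.
have -> : H * (u * v) - u * v * H = (H * u - u * H) * v + u * (H * v - v * H).
  by rewrite mulrBl mulrBr !mulrA addrA subrK.
by rewrite hu hv mulrzAl mulrzAr mulrzDr.
Qed.

Lemma has_weightD H H' u a b :
  has_weight H u a -> has_weight H' u b -> has_weight (H + H') u (a + b).
Proof.
rewrite /has_weight => hu hv.
by rewrite mulrDl mulrDr opprD addrACA hu hv mulrzDr.
Qed.

Lemma has_weightN H u a : has_weight H u a -> has_weight (- H) u (- a).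
Proof. by rewrite /has_weight => hu; rewrite mulNr mulrN -opprD hu mulrNz. Qed.

Lemma has_weight_sum (I : finType) (H : I -> W) u (a : I -> int) :
  (forall i, has_weight (H i) u (a i)) -> has_weight (\sum_i H i) u (\sum_i a i).
Proof.
move=> hu; apply: (big_ind2 (fun h z => has_weight h u z)) => // [|h z h' z'].
  by rewrite /has_weight mul0r mulr0 subrr mulr0z.
exact: has_weightD.
Qed.

(** Turns a weight into the intertwining form required by [pqnum_intertwine]. *)
Lemma has_weight_shift H u a : has_weight H u a -> u * H = (H - a%:~R) * u.
Proof. by rewrite /has_weight mulrBl mulrzl => <-; rewrite opprB addrC subrK. Qed.

End Weight.

(** * Extracting factors from the Serre expression *)

Section SerreExpression.
Variables (K : comNzRingType) (A : algType K) (Rel : set (fps A)).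
Local Notation W := (hpres Rel).
Implicit Types (x y u v : W) (c : fps K).

(* Both orders of nesting [x, [x, y]_d]_c with c d = 1 expand to this expression,
   at scalar c + d. *)
Definition serre c x y : W := x * x * y - c *: (x * y * x) + y * x * x.

(** In each of the three words the factors [u], [u], [v] can be moved to the right end. This
    isolates the single mode shared by two adjacent generators. *)
Lemma serreM c x y u v : GRing.comm u x -> GRing.comm u y -> GRing.comm v x ->
  GRing.comm u v -> serre c (x * u) (y * v) = serre c x y * (u * u * v).
Proof.
move=> ux uy vx uv.
(* The prefix [z] lets the commutations be rewritten inside left-associated products. *)
have ux' z : z * u * x = z * x * u by rewrite -!mulrA ux.
have uy' z : z * u * y = z * y * u by rewrite -!mulrA uy.
have vx' z : z * v * x = z * x * v by rewrite -!mulrA vx.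
have uv' z : z * v * u = z * u * v by rewrite -!mulrA uv.
rewrite /serre mulrDl mulrBl -hpres_scaleAl !mulrA.
by rewrite !(ux', uy', vx', uv').
Qed.

(** Meant for [z = [p-N]]: the second copy of [z] passes one [x] on its way to the left and becomes
    [z'], in each of the three words. *)
Lemma serreMl_shift c x y z z' : x * z = z' * x -> GRing.comm y z ->
  GRing.comm y z' -> serre c (z * x) y = z * z' * serre c x y.
Proof.
move=> xz yz yz'.
have xz1 w : w * x * z = w * z' * x by rewrite -!mulrA xz.
have yz1 w : w * y * z = w * z * y by rewrite -!mulrA yz.
have yz1' w : w * y * z' = w * z' * y by rewrite -!mulrA yz'.
rewrite /serre mulrDr mulrBr -hpres_scaleAr !mulrA.
by rewrite yz !(xz1, yz1, yz1').
Qed.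

Lemma serreMr c x y z : GRing.comm x z -> serre c x (z * y) = z * serre c x y.
Proof.
move=> xz; have xz1 w : w * x * z = w * z * x by rewrite -!mulrA xz.
by rewrite /serre mulrDr mulrBr -hpres_scaleAr !mulrA !(xz1, xz).
Qed.

End SerreExpression.

Section NumberWeights.
Variables (K : numFieldType) (A : algType K) (Rel : set (fps A)).
Local Notation W := (hpres Rel).
Local Notation rho := (pconst Rel).

Lemma weight_add_nat x u a m :
  has_weight (rho x) u a -> has_weight (rho (x + m%:R)) u a.
Proof.
move=> w; rewrite -[a]addr0 rmorphD rmorph_nat; apply: has_weightD => //.
by apply/has_weight0; exact: commr_nat.
Qed.

Lemma weight_pqnum x u (a : int) : has_weight (rho x) u a ->
  u * pqnum Rel x = pqnum Rel (x - a%:~R) * u.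
Proof.
move=> /has_weight_shift e; apply: pqnum_intertwine.
by rewrite rmorphB rmorph_int.
Qed.

Lemma comm_scalar (u : W) (c : K) : GRing.comm u (rho c%:A).
Proof.
by rewrite /GRing.comm pconstZ rmorph1 -hpres_scaleAr -hpres_scaleAl mulr1 mul1r.
Qed.

Lemma weight_scalarB c x u a :
  has_weight (rho x) u a -> has_weight (rho (c%:A - x)) u (- a).
Proof.
move=> w; rewrite rmorphB -[X in has_weight _ _ X]add0r; apply: has_weightD.
  by apply/has_weight0; exact: comm_scalar.
exact: has_weightN.
Qed.

Lemma comm_add1 (u : W) x : GRing.comm u (rho x) -> GRing.comm u (rho (x + 1)).
Proof. by move=> ux; rewrite rmorphD rmorph1; apply: commrD => //; exact: commr1. Qed.

End NumberWeights.

(* X i and Y i abstract [N_i+1]/(N_i+1) a_i^- and a_i^+. *)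
Record q_oscillators (K : numFieldType) (A : algType K) (Rel : set (fps A)) (n : nat)
    (num : 'I_n -> A) (X Y : 'I_n -> hpres Rel) : Prop := QOscillators {
  osc_num_comm : forall i j, GRing.comm (pconst Rel (num i)) (pconst Rel (num j));
  osc_X_weight : forall i j, has_weight (pconst Rel (num i)) (X j) (- (i == j)%:Z);
  osc_Y_weight : forall i j, has_weight (pconst Rel (num i)) (Y j) (i == j);
  osc_XX_comm : forall i j, GRing.comm (X i) (X j);
  osc_YY_comm : forall i j, GRing.comm (Y i) (Y j);
  osc_XY_comm : forall i j, i != j -> GRing.comm (X i) (Y j);
  osc_XY : forall i, X i * Y i = pqnum Rel (num i + 1);
  osc_YX : forall i, Y i * X i = pqnum Rel (num i)
}.

(** * The q-oscillators built from creation and annihilation operators *)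

Section Oscillators.
Variables (K : numFieldType) (A : algType K) (Rel : set (fps A)).
Local Notation W := (hpres Rel).
Local Notation rho := (pconst Rel).
Variables (n : nat) (cr an : 'I_n -> A).
Local Notation ap i := (rho (cr i)).
Local Notation am i := (rho (an i)).
Hypothesis am_ap : forall i j, am i * ap j - ap j * am i = (i == j)%:R.
Hypothesis ap_comm : forall i j, GRing.comm (ap i) (ap j).
Hypothesis am_comm : forall i j, GRing.comm (am i) (am j).

Definition onum i : A := cr i * an i.
Local Notation N_ i := (onum i).

Lemma am_ap_comm i j : i != j -> GRing.comm (am i) (ap j).
Proof.
by move=> /negPf ij; have /eqP := am_ap i j; rewrite ij subr_eq0 => /eqP.
Qed.

Lemma rho_num i : rho (N_ i) = ap i * am i. Proof. exact: rmorphM. Qed.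

Lemma num_ap_weight i j : has_weight (rho (N_ i)) (ap j) (i == j).
Proof.
rewrite /has_weight rho_num mulrA [ap j * _]ap_comm -!mulrA -mulrBr am_ap.
by case: eqP => [->|_]; rewrite ?mulr1 ?mulr0.
Qed.

Lemma num_am_weight i j : has_weight (rho (N_ i)) (am j) (- (i == j)%:Z).
Proof.
rewrite /has_weight rho_num -mulrA [am i * _]am_comm !mulrA -mulrBl.
rewrite -opprB am_ap eq_sym.
by case: eqP => [->|_]; rewrite ?mulN1r ?oppr0 ?mul0r.
Qed.

Lemma num_comm i j : GRing.comm (rho (N_ i)) (rho (N_ j)).
Proof.
(* The factors [ap i] and [am i] have opposite weights under [N_ j]. *)
apply/has_weight0; rewrite [rho (N_ i)]rho_num -[0](addrN (j == i : int)).
by apply: has_weightM; [exact: num_ap_weight|exact: num_am_weight].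
Qed.

Lemma pqdiv_comm u i : GRing.comm u (rho (N_ i)) -> GRing.comm u (pqdiv Rel (N_ i + 1)).
Proof.
move=> uN; apply: pqdiv_intertwine; rewrite rmorphD rmorph1.
by apply: commrD => //; exact: commr1.
Qed.

Definition oscX i : W := pqdiv Rel (N_ i + 1) * am i.

Lemma oscX_comm u i : GRing.comm u (rho (N_ i)) -> GRing.comm u (am i) ->
  GRing.comm u (oscX i).
Proof. by move=> uN ua; apply: commrM => //; exact: pqdiv_comm. Qed.

Lemma oscX_weight i j : has_weight (rho (N_ i)) (oscX j) (- (i == j)%:Z).
Proof.
rewrite -[X in has_weight _ _ X]add0r; apply: has_weightM; last exact: num_am_weight.
by apply/has_weight0/commr_sym/pqdiv_comm/num_comm.
Qed.

Lemma oscX_ap_comm i j : i != j -> GRing.comm (oscX i) (ap j).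
Proof.
move=> ij; apply/commr_sym/oscX_comm; last exact/commr_sym/am_ap_comm.
by apply/has_weight0; have := num_ap_weight i j; rewrite (negPf ij).
Qed.

Lemma oscX_oscX_comm i j : GRing.comm (oscX i) (oscX j).
Proof.
have [->//|ij] := eqVneq i j.
apply: oscX_comm.
  by apply/has_weight0; have := oscX_weight j i; rewrite eq_sym (negPf ij).
apply/commr_sym/oscX_comm; last exact: am_comm.
by apply/has_weight0; have := num_am_weight i j; rewrite (negPf ij).
Qed.

(** Here [am i * ap i] is the image of [N_ i + 1] and cancels the denominator. *)
Lemma oscX_ap i : oscX i * ap i = pqnum Rel (N_ i + 1).
Proof.
have e : am i * ap i = rho (N_ i + 1).
  by rewrite rmorphD rmorph1 /= rho_num addrC; apply/eqP; rewrite -subr_eq am_ap eqxx.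
rewrite /oscX -mulrA e.
by rewrite -pqdivE; apply/esym/pqdiv_intertwine.
Qed.

(** Moving [ap i] to the right turns [[N_i+1]/(N_i+1)] into [[N_i]/N_i], whose denominator is
    cancelled by [ap i * am i]. *)
Lemma ap_oscX i : ap i * oscX i = pqnum Rel (N_ i).
Proof.
rewrite /oscX mulrA (@pqdiv_intertwine _ _ _ _ _ (N_ i)) -?mulrA -?rho_num.
  by rewrite -pqdivE; apply/esym/pqdiv_intertwine.
have /(weight_add_nat 1)/has_weight_shift -> := num_ap_weight i i.
by rewrite eqxx rmorphD rmorph1 addrK.
Qed.

Lemma oscX_q_oscillators : q_oscillators onum oscX (fun i => ap i).
Proof.
split; [exact: num_comm|exact: oscX_weight|exact: num_ap_weight|
  exact: oscX_oscX_comm|exact: ap_comm|exact: oscX_ap_comm|exact: oscX_ap|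
  exact: ap_oscX].
Qed.

(** The left side has the factor order prescribed for the image of the first [e]; functions of the
    number operators commute. *)
Lemma oscX_qnum_tot c i :
  pqdiv Rel (N_ i + 1) * pqnum Rel (c%:A - \sum_j N_ j) * am i =
  pqnum Rel (c%:A - \sum_j N_ j) * oscX i.
Proof.
rewrite /oscX mulrA; congr (_ * _); apply/esym/pqdiv_comm/commr_sym.
apply: pqnum_intertwine; rewrite rmorphB rmorph_sum /=.
apply: commrB; first exact: comm_scalar.
by apply: commr_sum => j _; exact: num_comm.
Qed.

Lemma oscX_apC i j : i != j ->
  pqdiv Rel (N_ j + 1) * ap i * am j = oscX j * ap i.
Proof. by rewrite eq_sym => ij; rewrite /oscX -!mulrA (am_ap_comm ij). Qed.

End Oscillators.

(** * The quantum relations, derived from the oscillator axioms *)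

Section QuantumRelations.
Variables (K : numFieldType) (A : algType K) (Rel : set (fps A)) (n : nat).
Local Notation W := (hpres Rel).
Local Notation rho := (pconst Rel).
Variables (N_ : 'I_n -> A) (X Y : 'I_n -> W).
Hypothesis XYosc : q_oscillators N_ X Y.
Let N := \sum_i N_ i.
Let num_comm := osc_num_comm XYosc.
Let X_weight := osc_X_weight XYosc.
Let Y_weight := osc_Y_weight XYosc.
Let XX_comm := osc_XX_comm XYosc.
Let YY_comm := osc_YY_comm XYosc.
Let XY_comm := osc_XY_comm XYosc.
Let XY := osc_XY XYosc.
Let YX := osc_YX XYosc.
Local Notation q := (qpar K).

(** The words are [XXY = [N_i+2] X], [XYX = [N_i+1] X] and [YXX = [N_i] X], so the expression is the
    three-term recurrence times [X i]. *)
Lemma serre_XY i : serre (q + q^-1) (X i) (Y i) = 0.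
Proof.
have := X_weight i i; rewrite eqxx => w.
have w1 : has_weight (rho (N_ i + 1)) (X i) (- 1).
  exact: (weight_add_nat 1).
rewrite /serre -mulrA !XY YX (weight_pqnum w1) hpres_scaleAl -mulrBl -mulrDl.
by rewrite mulrN1z opprK -[_ + 1 + 1]addrA pqnum_recurrence mul0r.
Qed.

(** Here [Y i] comes out on the left: [YYX = Y [N_i]], [YXY = Y [N_i+1]] and [XYY = Y [N_i+2]]. *)
Lemma serre_YX i : serre (q + q^-1) (Y i) (X i) = 0.
Proof.
have w1 : has_weight (rho (N_ i + 2)) (Y i) 1.
  by have := weight_add_nat 2 (Y_weight i i); rewrite eqxx.
have e := weight_pqnum w1.
have shift : pqnum Rel (N_ i + 2 - 1%:~R) = pqnum Rel (N_ i + 1).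
  by rewrite -addrA; congr (pqnum _ (_ + _)); rewrite [2](_ : _ = 1 + 1) // addrK.
rewrite /serre -[Y i * Y i * _]mulrA -[Y i * X i * _]mulrA YX XY.
rewrite -shift -e shift hpres_scaleAr -mulrBr -mulrDr.
have := pqnum_recurrence Rel (N_ i).
by rewrite addrAC [X in X - _]addrC addrAC => ->; rewrite mulr0.
Qed.

Variable p : K.
Let T := p%:A - N.

Lemma tot_Y_weight j : has_weight (rho N) (Y j) 1.
Proof.
have <- : \sum_i (i == j : int) = 1.
  by rewrite (bigD1 j) //= eqxx big1 ?addr0 // => i /negPf->.
rewrite rmorph_sum; apply: has_weight_sum => i; exact: Y_weight.
Qed.

Lemma tot_X_weight j : has_weight (rho N) (X j) (- 1).
Proof.
have <- : \sum_i - (i == j : int) = - 1.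
  by rewrite sumrN (bigD1 j) //= eqxx big1 ?addr0 // => i /negPf->.
rewrite rmorph_sum; apply: has_weight_sum => i; exact: X_weight.
Qed.

Variables (hA : 'I_n -> A) (e f : 'I_n -> W).
Hypothesis h0 : forall i : 'I_n, i = 0%N :> nat -> hA i = T - N_ i.
Hypothesis hS : forall i j : 'I_n, i = j.+1 :> nat -> hA i = N_ j - N_ i.
Hypothesis e0 : forall i : 'I_n, i = 0%N :> nat -> e i = pqnum Rel T * X i.
Hypothesis eS : forall i j : 'I_n, i = j.+1 :> nat -> e i = X i * Y j.
Hypothesis f0 : forall i : 'I_n, i = 0%N :> nat -> f i = Y i.
Hypothesis fS : forall i j : 'I_n, i = j.+1 :> nat -> f i = X j * Y i.

Lemma ord_zero_or_succ (i : 'I_n) :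
  i = 0%N :> nat \/ exists j : 'I_n, i = j.+1 :> nat.
Proof.
case: i => [[|j] lt_jn]; first by left.
by right; exists (Ordinal (ltnW lt_jn)).
Qed.

Lemma comm_tot (u : W) : (forall i, GRing.comm u (rho (N_ i))) -> GRing.comm u (rho T).
Proof.
move=> uN; rewrite rmorphB rmorph_sum; apply: commrB; first exact: comm_scalar.
by apply: commr_sum => i _; exact: uN.
Qed.

Lemma comm_h (u : W) i :
  (forall i, GRing.comm u (rho (N_ i))) -> GRing.comm u (rho (hA i)).
Proof.
move=> uN; have [i0|[j ij]] := ord_zero_or_succ i.
  rewrite (h0 i0) (rmorphB (pconst Rel)) /=; apply: commrB => //.
  exact: comm_tot uN.
by rewrite (hS ij) rmorphB; apply: commrB; exact: uN.
Qed.

Lemma h_h i j : GRing.comm (rho (hA i)) (rho (hA j)).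
Proof.
by apply: comm_h => k; apply/commr_sym/comm_h => l; exact: num_comm.
Qed.

(** One formula serves both shapes of [e i]: for [i = 0] the first indicator is 0, in accordance
    with the missing [Y]. *)
Lemma e_num_weight m i :
  has_weight (rho (N_ m)) (e i) ((m.+1 == i :> nat)%:Z - (m == i :> nat)%:Z).
Proof.
have wX j : has_weight (rho (N_ m)) (X j) (- (m == j :> nat)%:Z).
  by have := X_weight m j.
have [i0|[j ij]] := ord_zero_or_succ i.
  rewrite (e0 i0) {1}i0 /=; apply: has_weightM; last exact: wX.
  by apply/has_weight0/commr_sym/pqnum_intertwine/comm_tot => k; exact: num_comm.
rewrite (eS ij) {1}ij eqSS addrC; apply: has_weightM; first exact: wX.
exact: Y_weight.
Qed.

(** [X] raises [T] by one and [Y] lowers it by one, so only [e] of index 0 has a nonzero weight. *)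
Lemma e_tot_weight i : has_weight (rho T) (e i) (i == 0%N :> nat).
Proof.
have wX j : has_weight (rho T) (X j) 1.
  by have := weight_scalarB p (tot_X_weight j); rewrite opprK.
have wA j : has_weight (rho T) (Y j) (- 1).
  exact: weight_scalarB (tot_Y_weight j).
have [i0|[j ij]] := ord_zero_or_succ i.
  rewrite (e0 i0) i0 -[X in has_weight _ _ X]add0r; apply: has_weightM => //.
  by apply/has_weight0/commr_sym/pqnum_intertwine.
by rewrite (eS ij) ij; exact: (has_weightM (wX i) (wA j)).
Qed.

Lemma f_num_weight m i :
  has_weight (rho (N_ m)) (f i) (- ((m.+1 == i :> nat)%:Z - (m == i :> nat)%:Z)).
Proof.
have wA j : has_weight (rho (N_ m)) (Y j) (m == j :> nat) by exact: Y_weight.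
have wX j : has_weight (rho (N_ m)) (X j) (- (m == j :> nat)%:Z).
  by have := X_weight m j.
have [i0|[j ij]] := ord_zero_or_succ i.
  by rewrite (f0 i0) {1}i0 /= add0r opprK.
by rewrite (fS ij) {1}ij eqSS opprB addrC; apply: has_weightM.
Qed.

Lemma f_tot_weight i : has_weight (rho T) (f i) (- (i == 0%N :> nat)%:Z).
Proof.
have wX j : has_weight (rho T) (X j) 1.
  by have := weight_scalarB p (tot_X_weight j); rewrite opprK.
have wA j : has_weight (rho T) (Y j) (- 1).
  exact: weight_scalarB (tot_Y_weight j).
have [i0|[j ij]] := ord_zero_or_succ i; first by rewrite (f0 i0) i0.
by rewrite (fS ij) ij; exact: (has_weightM (wX j) (wA i)).
Qed.

(** Weights are additive in the Cartan element, so those of the two terms of [hA i] are subtracted;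
    for [i = 0], [T] takes the place of the preceding number operator. *)
Lemma h_e i j : has_weight (rho (hA i)) (e j) (cartan i j).
Proof.
have [i0|[k ik]] := ord_zero_or_succ i.
  rewrite (h0 i0) rmorphB /=.
  have := has_weightD (e_tot_weight j) (has_weightN (e_num_weight i j)).
  congr has_weight; rewrite /cartan -val_eqE /= i0 eq_sym /=.
  by case: eqP; case: eqP.
rewrite (hS ik) rmorphB /=.
have := has_weightD (e_num_weight k j) (has_weightN (e_num_weight i j)).
congr has_weight; rewrite /cartan -val_eqE /= ik eqSS.
lia.
Qed.

Lemma h_f i j : has_weight (rho (hA i)) (f j) (- cartan i j).
Proof.
have [i0|[k ik]] := ord_zero_or_succ i.
  rewrite (h0 i0) rmorphB /=.
  have := has_weightD (f_tot_weight j) (has_weightN (f_num_weight i j)).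
  congr has_weight; rewrite /cartan -val_eqE /= i0 eq_sym /=.
  by case: eqP; case: eqP.
rewrite (hS ik) rmorphB /=.
have := has_weightD (f_num_weight k j) (has_weightN (f_num_weight i j)).
congr has_weight; rewrite /cartan -val_eqE /= ik eqSS.
lia.
Qed.

Lemma commrMM (a b c d : W) : GRing.comm a c -> GRing.comm a d ->
  GRing.comm b c -> GRing.comm b d -> GRing.comm (a * b) (c * d).
Proof.
by move=> ac ad bc bd; apply: commrM; apply/commr_sym; apply: commrM; exact: commr_sym.
Qed.

Lemma YX_comm i j : i != j -> GRing.comm (Y i) (X j).
Proof. by rewrite eq_sym => ij; exact/commr_sym/XY_comm. Qed.

Lemma ord_neq (i j : 'I_n) : i <> j :> nat -> i != j.
Proof. by move=> ij; apply/eqP => /(congr1 val). Qed.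

Lemma tot_comm_qnum u m :
  has_weight (rho T) u 0 -> GRing.comm u (pqnum Rel (T - m%:~R)).
Proof.
move=> /has_weight0 w; apply: pqnum_intertwine; rewrite rmorphB rmorph_int.
by apply: commrB => //; exact: commr_int.
Qed.

Lemma e_f i : e i * f i - f i * e i = pqnum Rel (hA i).
Proof.
have [i0|[j ij]] := ord_zero_or_succ i.
  (* Since [Y i] turns [[T]] into [[T+1]], the commutator is [[T] [N_i+1] - [T+1] [N_i]]. *)
  have wT := weight_scalarB p (tot_Y_weight i).
  rewrite (e0 i0) (f0 i0) (h0 i0) -mulrA XY [Y i * (_ * _)]mulrA.
  rewrite (weight_pqnum wT) mulrN1z opprK -[_ * Y i * _]mulrA YX.
  have cNT : GRing.comm (rho (N_ i)) (rho T) by apply: comm_tot => k; exact: num_comm.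
  have cN1T : GRing.comm (rho (N_ i + 1)) (rho T).
    exact/commr_sym/comm_add1/commr_sym.
  rewrite -[pqnum Rel T * _](pqnum_comm cN1T).
  by rewrite -[pqnum Rel (T + 1) * _](pqnum_comm (comm_add1 cNT)) pqnum_det.
(* Grouping by modes gives [[N_i+1] [N_j] - [N_i] [N_j+1]]. *)
have ne : i != j by apply: ord_neq; lia.
rewrite (eS ij) (fS ij) (hS ij) -(pqnum_det (num_comm i j)).
rewrite -XY -[pqnum Rel (N_ j)]YX -[pqnum Rel (N_ i)]YX.
rewrite -[pqnum Rel (N_ j + 1)]XY -!mulrA; congr (_ * _ - _).
  by rewrite [RHS](commrM (YY_comm i j) (YX_comm ne)) mulrA.
by rewrite mulrA -(YX_comm ne) -mulrA; congr (_ * _); rewrite !mulrA XX_comm.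
Qed.

(** For positive indices, an [X] meets a [Y] only in modes [i], [j] and in their predecessors, which
    differ as well. In index 0, [[T]] commutes with [f j] because [f j] preserves the total
    number. *)
Lemma e_f_neq i j : i != j -> GRing.comm (e i) (f j).
Proof.
have aX := YX_comm; have Xa := XY_comm.
have XX := XX_comm; have aa := YY_comm.
move=> ij; have [i0|[k ik]] := ord_zero_or_succ i;
  have [j0|[l jl]] := ord_zero_or_succ j.
- by move: ij; rewrite -val_eqE /= i0 j0.
- rewrite (e0 i0) -[f j]mul1r; apply: commrMM; try exact: commr1.
    rewrite -[T]subr0 -[0](mulr0z 1); apply/commr_sym/tot_comm_qnum.
    by have := f_tot_weight j; rewrite jl.
  by rewrite (fS jl); apply: commrM; [exact: XX|exact: Xa].
- by rewrite (eS ik) (f0 j0); apply/commr_sym/commrM; [apply: aX; rewrite eq_sym|].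
rewrite (eS ik) (fS jl); apply: commrMM => //; [exact: Xa|].
by apply: aX; apply: ord_neq => kl; case/eqP: ij; apply: val_inj; rewrite /= ik jl kl.
Qed.

Lemma e_comm_qnum (i : 'I_n) (m : int) :
  (0 < i)%N -> GRing.comm (e i) (pqnum Rel (T - m%:~R)).
Proof. by case: (val i) (e_tot_weight i) => // k w _; exact: tot_comm_qnum. Qed.

(** An [X] of one generator shares its mode with a [Y] of the other only for adjacent indices. *)
Lemma e_e (i j : 'I_n) : `|i - j|%N <> 1%N -> GRing.comm (e i) (e j).
Proof.
have aX := YX_comm; have Xa := XY_comm.
have XX := XX_comm; have aa := YY_comm.
wlog le_ij : i j / (i <= j)%N.
  move=> th ij1; have [ij|/ltnW ji] := leqP i j; first exact: th.
  by apply/commr_sym/th => //; lia.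
move=> ij1; have [i0|[k ik]] := ord_zero_or_succ i;
  have [j0|[l jl]] := ord_zero_or_succ j; try lia.
- by have -> : i = j by apply: val_inj; rewrite /= i0.
- rewrite (e0 i0); apply/commr_sym/commrM.
    by have := @e_comm_qnum j 0; rewrite mulr0z subr0; apply; rewrite jl.
  rewrite (eS jl); apply/commr_sym/commrM => //; apply: Xa; apply: ord_neq; lia.
have [->//|/eqP ij] := eqVneq i j.
rewrite (eS ik) (eS jl); apply: commrMM => //.
  apply: Xa; apply: ord_neq; lia.
apply: aX; apply: ord_neq; lia.
Qed.

Lemma f_f (i j : 'I_n) : `|i - j|%N <> 1%N -> GRing.comm (f i) (f j).
Proof.
have aX := YX_comm; have Xa := XY_comm.
have XX := XX_comm; have aa := YY_comm.
wlog le_ij : i j / (i <= j)%N.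
  move=> th ij1; have [ij|/ltnW ji] := leqP i j; first exact: th.
  by apply/commr_sym/th => //; lia.
move=> ij1; have [i0|[k ik]] := ord_zero_or_succ i;
  have [j0|[l jl]] := ord_zero_or_succ j; try lia.
- by have -> : i = j by apply: val_inj; rewrite /= i0.
- rewrite (f0 i0) (fS jl); apply: commrM => //; apply: aX; apply: ord_neq; lia.
have [->//|/eqP ij] := eqVneq i j.
rewrite (fS ik) (fS jl); apply: commrMM => //.
  apply: Xa; apply: ord_neq; lia.
apply: aX; apply: ord_neq; lia.
Qed.

(** Adjacent generators share one mode, in which one carries [X] and the other [Y]. All remaining
    factors are extracted, leaving [serre_XY] if [j = i + 1] and [serre_YX] if [i = j + 1]. *)
Lemma serre_e (i j : 'I_n) : `|i - j|%N = 1%N -> serre (q + q^-1) (e i) (e j) = 0.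
Proof.
have aX := YX_comm; have Xa := XY_comm.
have XX := XX_comm; have aa := YY_comm.
have c1 (u : W) : GRing.comm u 1 by exact: commr1.
have c1' (u : W) : GRing.comm 1 u by exact/commr_sym/commr1.
have aXC (k l : 'I_n) : k != l -> Y k * X l = X l * Y k by exact: aX.
move=> ij1; have [i0|[k ik]] := ord_zero_or_succ i;
  have [j0|[l jl]] := ord_zero_or_succ j; try lia.
- have ne : i != j by apply: ord_neq; lia.
  have li : l = i by apply: ord_inj; lia.
  subst l.
  have wX : has_weight (rho T) (X i) 1.
    by have := weight_scalarB p (tot_X_weight i); rewrite opprK.
  have cP m : GRing.comm (e j) (pqnum Rel (T - m%:~R)) by apply: e_comm_qnum; lia.
  (* The two factors [[T]] come out as [[T] [T-1]]. *)
  rewrite (e0 i0) (serreMl_shift _ (weight_pqnum wX)) //.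
    rewrite (eS jl) -(aXC i j ne).
    (* The inserted 1 stands for the [Y] that the first generator lacks, so that [serreM]
       applies. *)
    by rewrite -[X i]mulr1 serreM ?serre_XY ?mul0r ?mulr0.
  by have := cP 0; rewrite mulr0z subr0.
- have ne : i != j by apply: ord_neq; lia.
  have kj : k = j by apply: ord_inj; lia.
  subst k.
  have cP : GRing.comm (e i) (pqnum Rel T).
    have := @e_comm_qnum i 0; rewrite mulr0z subr0; apply; lia.
  (* Now [[T]] occurs once, in [e j], and [e i] commutes with it. *)
  rewrite (e0 j0) serreMr // (eS ik) -(aXC j i) 1?eq_sym //.
  by rewrite -[Z in serre _ _ Z]mulr1 serreM ?serre_YX ?mul0r ?mulr0 //; exact: Xa.
have [jE|ne] := eqVneq (j : nat) i.+1.
  have li : l = i by apply: ord_inj; lia.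
  subst l; rewrite (eS ik) (eS jl) -(aXC i j); last by apply: ord_neq; lia.
  by rewrite serreM ?serre_XY ?mul0r //; apply: aX; apply: ord_neq; lia.
have kj : k = j by apply: ord_inj; lia.
subst k; rewrite (eS ik) (eS jl) -(aXC j i); last by apply: ord_neq; lia.
by rewrite serreM ?serre_YX ?mul0r //; apply: Xa; apply: ord_neq; lia.
Qed.

(** The argument for [serre_e] with [X] and [Y] exchanged; no factor [[T]] occurs. *)
Lemma serre_f (i j : 'I_n) : `|i - j|%N = 1%N -> serre (q + q^-1) (f i) (f j) = 0.
Proof.
have aX := YX_comm; have Xa := XY_comm.
have XX := XX_comm; have aa := YY_comm.
have c1 (u : W) : GRing.comm u 1 by exact: commr1.
have c1' (u : W) : GRing.comm 1 u by exact/commr_sym/commr1.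
have aXC (k l : 'I_n) : k != l -> Y k * X l = X l * Y k by exact: aX.
move=> ij1; have [i0|[k ik]] := ord_zero_or_succ i;
  have [j0|[l jl]] := ord_zero_or_succ j; try lia.
- have li : l = i by apply: ord_inj; lia.
  by subst l; rewrite (f0 i0) (fS jl) -[Y i]mulr1 serreM ?serre_YX ?mul0r.
- have kj : k = j by apply: ord_inj; lia.
  subst k; rewrite (f0 j0) (fS ik) -[Y j]mulr1.
  by rewrite serreM ?serre_XY ?mul0r //; apply: aX; apply: ord_neq; lia.
have [jE|ne] := eqVneq (j : nat) i.+1.
  have li : l = i by apply: ord_inj; lia.
  subst l; rewrite (fS ik) (fS jl) -(aXC i k); last by apply: ord_neq; lia.
  by rewrite serreM ?serre_YX ?mul0r //; apply: Xa; apply: ord_neq; lia.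
have kj : k = j by apply: ord_inj; lia.
subst k; rewrite (fS ik) (fS jl) -(aXC j l); last by apply: ord_neq; lia.
by rewrite serreM ?serre_XY ?mul0r //; apply: aX; apply: ord_neq; lia.
Qed.

End QuantumRelations.

(** * The realization *)

Section RelationImages.
Variables (K : numFieldType) (A B : algType K) (ev : {rmorphism A -> fps B}).
Variable RelB : set (fps B).
Hypothesis evZ : forall (c : K) a, ev (c *: a) = fps_const c *: ev a.
Local Notation psi s := (hpi RelB (fps_ext ev s)).
Local Notation q := (qpar K).
Implicit Types (x y w : fps A).

Lemma ext_comm x y : psi (comm x y) = psi x * psi y - psi y * psi x.
Proof. by rewrite /comm (fps_extB ev) !(fps_extM ev).2 rmorphB !rmorphM. Qed.

Lemma ext_qcomm (c : fps K) x y :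
  psi (qcomm c x y) = psi x * psi y - c *: (psi y * psi x).
Proof.
rewrite /qcomm (fps_extB ev) rmorphB /= (fps_extZ evZ) [X in _ - X]linearZ /=.
by rewrite !(fps_extM ev).2 !(rmorphM (hpi RelB)).
Qed.

(** As [ev a] is a constant series, [fps_ext ev] acts on each coefficient separately: only the
    summand [i = k] contributes to coefficient [k]. *)
Lemma ext_qnum a b : ev a = fps_const b -> psi (qnum a) = pqnum RelB b.
Proof.
move=> eab; congr (hpi RelB); rewrite /qnum (fps_extZ evZ); congr (_ *: _).
have e k : ev (qexp a k) = fps_const (qexp b k).
  by rewrite [LHS]evZ [RHS]fps_constZ rmorphXn /= eab rmorphXn.
have eN k : ev (qexp (- a) k) = fps_const (qexp (- b) k).
  by rewrite [LHS]evZ [RHS]fps_constZ rmorphXn rmorphN /= eab rmorphXn rmorphN.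
apply: fpsP => k; rewrite fps_ext_coef.
transitivity (\sum_(i < k.+1) fps_const (qexp b i.+1 - qexp (- b) i.+1) (k - i)%N).
  by apply: eq_bigr => i _; rewrite [fps_divh _ i]/(_ - _) rmorphB e eN -rmorphB.
rewrite big_ord_recr /= subnn big1 ?add0r // => i _.
by rewrite subn_eq0 leqNgt ltn_ord.
Qed.

Variables (x y : fps A) (u v : hpres RelB).
Hypotheses (xu : psi x = u) (yv : psi y = v).

Lemma ext_commute : GRing.comm u v -> psi (comm x y) = 0.
Proof. by move=> uv; rewrite ext_comm xu yv uv subrr. Qed.

Lemma ext_commute_sub0 : GRing.comm u v -> psi (comm x y - 0) = 0.
Proof. by rewrite subr0; exact: ext_commute. Qed.

Lemma ext_comm_eq w : u * v - v * u = psi w -> psi (comm x y - w) = 0.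
Proof. by move=> e; rewrite (fps_extB ev) rmorphB /= ext_comm xu yv e subrr. Qed.

Lemma ext_comm_weight (z : int) : has_weight u v z -> psi (comm x y - y *~ z) = 0.
Proof. by move=> w; apply: ext_comm_eq; rewrite w -yv -!raddfMz. Qed.

Lemma ext_serre (c d : fps K) : c * d = 1 -> serre (c + d) u v = 0 ->
  psi (qcomm c x (qcomm d x y)) = 0.
Proof.
move=> cd; rewrite !ext_qcomm xu yv => <-; rewrite /serre.
rewrite mulrBr mulrBl scalerBr -hpres_scaleAr -hpres_scaleAl scalerA cd scale1r !mulrA.
by rewrite opprB addrA addrAC scalerDl opprD addrA [X in X + _ = _]addrAC.
Qed.

End RelationImages.

(** * Images of the generators in the Weyl algebra *)

Section Realization.
Variables (K : numFieldType) (n : nat) (p : K).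
Local Notation Rel := (@Weyl_rel K n).
Local Notation N_ := (@num_op K n).
Local Notation N := (num_tot K n).
Local Notation cr i := (fgen K (genAp i)).
Local Notation an i := (fgen K (genAm i)).

Lemma Weyl_rel0 s : Rel s -> hpi Rel s = 0.
Proof.
move=> rs; rewrite -(rmorph0 (hpi Rel)); apply/hpi_eq; rewrite subr0.
exact: sub_gen_closed_ideal.
Qed.

Lemma Weyl_am_ap i j : pconst Rel (an i) * pconst Rel (cr j) -
  pconst Rel (cr j) * pconst Rel (an i) = (i == j)%:R.
Proof.
have /eqP := Weyl_rel0 (Weyl_mp K i j).
by rewrite (rmorphB (hpi Rel)) /= hpi_comm (rmorph_nat (hpi Rel)) subr_eq0 => /eqP.
Qed.

Lemma Weyl_ap_comm i j : GRing.comm (pconst Rel (cr i)) (pconst Rel (cr j)).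
Proof.
by have /eqP := Weyl_rel0 (Weyl_pp K i j); rewrite hpi_comm subr_eq0 => /eqP.
Qed.

Lemma Weyl_am_comm i j : GRing.comm (pconst Rel (an i)) (pconst Rel (an j)).
Proof.
by have /eqP := Weyl_rel0 (Weyl_mm K i j); rewrite hpi_comm subr_eq0 => /eqP.
Qed.

(** Index 0 is its own predecessor by default; [h_image] and [gen_image] treat that index in a
    separate branch. *)
Definition opred (i : 'I_n) : 'I_n :=
  Ordinal (leq_ltn_trans (leq_pred i) (ltn_ord i)).

Lemma opredS (i j : 'I_n) : i = j.+1 :> nat -> opred i = j.
Proof. by move=> ij; apply: val_inj; rewrite /= ij. Qed.

Definition h_image (i : 'I_n) : falg K (Weyl_gen n) :=
  if i == 0%N :> nat then p%:A - N - N_ i else N_ (opred i) - N_ i.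

(** Lifts of the prescribed images to series over the free algebra, with factors in the prescribed
    order; the equations below rewrite their classes in terms of [oscX]. *)
Definition gen_image (g : Uq_gen n) : fps (falg K (Weyl_gen n)) :=
  match g with
  | genH i => fps_const (h_image i)
  | genE i =>
    if i == 0%N :> nat
    then qnum_div (N_ i + 1) * qnum (p%:A - N) * fps_const (an i)
    else qnum_div (N_ i + 1) * fps_const (an i) * fps_const (cr (opred i))
  | genF i =>
    if i == 0%N :> nat then fps_const (cr i)
    else qnum_div (N_ (opred i) + 1) * fps_const (cr i) * fps_const (an (opred i))
  end.

Local Notation oscX := (oscX Rel (fun i : 'I_n => cr i) (fun i : 'I_n => an i)).
Local Notation h i := (pconst Rel (h_image i)).
Local Notation e i := (hpi Rel (gen_image (genE i))).
Local Notation f i := (hpi Rel (gen_image (genF i))).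

Lemma Weyl_q_oscillators :
  q_oscillators (fun i => N_ i) oscX (fun i => pconst Rel (cr i)).
Proof. exact: (oscX_q_oscillators Weyl_am_ap Weyl_ap_comm Weyl_am_comm). Qed.

Lemma h_image0 (i : 'I_n) : i = 0%N :> nat -> h_image i = p%:A - N - N_ i.
Proof. by rewrite /h_image => ->. Qed.

Lemma h_imageS (i j : 'I_n) : i = j.+1 :> nat -> h_image i = N_ j - N_ i.
Proof. by move=> ij; rewrite /h_image (opredS ij) ij. Qed.

Lemma e_image0 (i : 'I_n) : i = 0%N :> nat -> e i = pqnum Rel (p%:A - N) * oscX i.
Proof.
rewrite /gen_image => -> /=; rewrite !(rmorphM (hpi Rel)).
exact: (oscX_qnum_tot Weyl_am_ap Weyl_ap_comm Weyl_am_comm).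
Qed.

Lemma e_imageS (i j : 'I_n) : i = j.+1 :> nat -> e i = oscX i * pconst Rel (cr j).
Proof.
by move=> ij; rewrite /gen_image (opredS ij) ij /= !(rmorphM (hpi Rel)).
Qed.

Lemma f_image0 (i : 'I_n) : i = 0%N :> nat -> f i = pconst Rel (cr i).
Proof. by rewrite /gen_image => ->. Qed.

Lemma f_imageS (i j : 'I_n) : i = j.+1 :> nat -> f i = oscX j * pconst Rel (cr i).
Proof.
move=> ij; rewrite /gen_image (opredS ij) ij /= !(rmorphM (hpi Rel)).
apply: (oscX_apC Weyl_am_ap); apply: ord_neq; lia.
Qed.

Local Notation ev := (falg_eval gen_image).
Local Notation psi s := (hpi Rel (fps_ext ev s)).

Lemma psi_gen g : psi (fps_const (fgen K g)) = hpi Rel (gen_image g).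
Proof. by rewrite fps_ext_const /= falg_eval_gen. Qed.

Lemma Uq_rel_image r : @Uq_rel K n r -> psi r = 0.
Proof.
have osc := Weyl_q_oscillators.
have evZ := falg_evalZ gen_image.
have qV : qpar K * (qpar K)^-1 = 1 by exact: qparVr.
have Vq : (qpar K)^-1 * qpar K = 1 by rewrite mulrC.
have pH k : psi (fps_const (fgen K (genH k))) = pconst Rel (h_image k) := psi_gen _.
have pE k := psi_gen (genE k); have pF k := psi_gen (genF k).
case=> {r} [i j|i j|i j|i j|i j ij|i j ij|i j ij|i j ij|i j ij|i j ij].
- exact: (ext_commute (pH i) (pH j) (h_h osc h_image0 h_imageS i j)).
- exact: (ext_comm_weight (pH i) (pE j)
    (h_e osc h_image0 h_imageS e_image0 e_imageS i j)).
- exact: (ext_comm_weight (pH i) (pF j)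
    (h_f osc h_image0 h_imageS f_image0 f_imageS i j)).
- case: eqVneq => [<-|ij]; last first.
    exact: (ext_commute_sub0 (pE i) (pF j)
      (e_f_neq osc e_image0 e_imageS f_image0 f_imageS ij)).
  apply: (ext_comm_eq (pE i) (pF i)).
  have -> := ext_qnum Rel evZ (falg_eval_gen gen_image (genH i)).
  exact: (e_f osc h_image0 h_imageS e_image0 e_imageS f_image0 f_imageS).
- exact: (ext_commute (pE i) (pE j) (e_e osc e_image0 e_imageS ij)).
- exact: (ext_commute (pF i) (pF j) (f_f osc f_image0 f_imageS ij)).
- exact: (ext_serre evZ (pE i) (pE j) qV (serre_e osc e_image0 e_imageS ij)).
(* The other nesting order yields the scalar [q^-1 + q], hence the same Serre expression. *)
- apply: (ext_serre evZ (pE i) (pE j) Vq).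
  rewrite addrC; exact: (serre_e osc e_image0 e_imageS ij).
- exact: (ext_serre evZ (pF i) (pF j) qV (serre_f osc f_image0 f_imageS ij)).
- apply: (ext_serre evZ (pF i) (pF j) Vq).
  rewrite addrC; exact: (serre_f osc f_image0 f_imageS ij).
Qed.

Lemma Uq_morphism : exists phi : {rmorphism Uq K n -> Weyl K n},
  (forall c u, phi (c *: u) = c *: phi u) /\
  (forall g, phi (hpi (@Uq_rel K n) (fps_const (fgen K g))) = to_Weyl (gen_image g)).
Proof.
have [phi [phiZ phiE]] := hpres_lift (falg_evalZ gen_image) Uq_rel_image.
exists phi; split=> // g; rewrite phiE; exact: psi_gen.
Qed.

End Realization.

Theorem proposition1 (R : realType) (n : nat) (n_ge1 : (1 <= n)%N) (p : R[i]) :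
  let N_ := @num_op R[i] n in
  let N := num_tot R[i] n in
  let ap := @Weyl_ap R[i] n in
  let am := @Weyl_am R[i] n in
  exists phi : {rmorphism Uq R[i] n -> Weyl R[i] n},
    (forall (c : fps R[i]) (u : Uq R[i] n), phi (c *: u) = c *: phi u) /\
    (forall i : 'I_n, i = 0%N :> nat ->
      [/\ phi (Uq_h _ i) = to_Weyl (fps_const (p%:A - N - N_ i)),
          phi (Uq_e _ i) =
            to_Weyl (qnum_div (N_ i + 1) * qnum (p%:A - N)) * am i
        & phi (Uq_f _ i) = ap i]) /\
    (forall i j : 'I_n, i = j.+1 :> nat ->
      [/\ phi (Uq_h _ i) = to_Weyl (fps_const (N_ j - N_ i)),
          phi (Uq_e _ i) = to_Weyl (qnum_div (N_ i + 1)) * am i * ap j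
        & phi (Uq_f _ i) = to_Weyl (qnum_div (N_ j + 1)) * ap i * am j]).
Proof.
move=> N_ N ap am; have [phi [phiZ phiE]] := Uq_morphism n p.
exists phi; split=> //; split=> [i i0|i j ij]; split; rewrite [LHS]phiE /=.
- by rewrite (h_image0 _ i0).
- by rewrite i0 [LHS]rmorphM.
- by rewrite i0.
- by rewrite (h_imageS _ ij).
- by rewrite ij (opredS ij) /to_Weyl !(rmorphM (hpi (@Weyl_rel R[i] n))).
- by rewrite ij (opredS ij) /to_Weyl !(rmorphM (hpi (@Weyl_rel R[i] n))).
Qed.
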